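(* Let $\mathcal{X}=(X,\{R_0,R_1,R_2,R_3\})$ be a symmetric association scheme with $3$ classes (so $R_0=\{(x,x)\mid x\in X\}$, the relations $R_0,\dots,R_3$ partition $X\times X$, each $R_i$ is symmetric, and the adjacency matrices satisfy $A_iA_j=\sum_{k=0}^3 p_{i,j}^k A_k$ with nonnegative integers $p_{i,j}^k$), whose intersection numbers are as follows. Here $p_{0,j}^k=\delta_{jk}$, and for $i=1,2,3$ we list, for each $k=0,1,2,3$, the row $(p_{i,0}^k,p_{i,1}^k,p_{i,2}^k,p_{i,3}^k)$: - $i=1$: $k=0$: $(0,30,0,0)$; $k=1$: $(1,15,10,4)$; $k=2$: $(0,15,6,9)$; $k=3$: $(0,8,12,10)$. - $i=2$: $k=0$: $(0,0,20,0)$; $k=1$: $(0,10,4,6)$; $k=2$: $(1,6,10,3)$; $k=3$: $(0,12,4,4)$. - $i=3$: $k=0$: $(0,0,0,15)$; $k=1$: $(0,4,6,5)$; $k=2$: $(0,9,3,3)$; $k=3$: $(1,10,4,0)$. Then $\mathcal{X}$ is isomorphic to the scheme $\mathcal{W}$ defined in the context; that is, there is a bijection $\phi:X\to W_{11}$ such that $(x,y)\in R_i$ if and only if $(\phi(x),\phi(y))\in R_i^{\mathcal{W}}$, for each $i=0,1,2,3$.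
   Context: A $t$-$(v,k,\lambda)$ design is a collection of $k$-subsets (blocks) of a $v$-set of points such that every $t$-subset of points is contained in exactly $\lambda$ blocks. Let $W_{11}$ be the Witt $4$-$(11,5,1)$ design (the unique, up to isomorphism, $4$-$(11,5,1)$ design); it has $66$ blocks and any two distinct blocks meet in $1$, $2$ or $3$ points. The scheme $\mathcal{W}=(W_{11},\{R_0^{\mathcal{W}},R_1^{\mathcal{W}},R_2^{\mathcal{W}},R_3^{\mathcal{W}}\})$ has as vertex set the set of blocks of $W_{11}$, with $R_0^{\mathcal{W}}$ the identity relation and, for $i=1,2,3$, $(B,B')\in R_i^{\mathcal{W}}$ if and only if $B\ne B'$ and $|B\cap B'|=4-i$. This is a $3$-class (Q-polynomial) association scheme. *)

(* Defs.v *)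
From mathcomp Require Import all_boot all_order all_algebra.

Set Implicit Arguments.
Unset Strict Implicit.
Unset Printing Implicit Defensive.

Import GRing.Theory.
Local Open Scope ring_scope.

Section Schemes.

Variables (d : nat) (X : finType).

(* Rows and columns are indexed by X through its enumeration. *)
Definition adjacency (R : {set X * X}) : 'M[int]_#|X| :=
  \matrix_(a, b) ((enum_val a, enum_val b) \in R)%:R.

(* [partition] makes every R_i nonempty, and X as well; [scheme_inj] is what
   makes relations with distinct indices disjoint. *)
Record symmetric_scheme := SymmetricScheme {
  scheme_rel :> 'I_d.+1 -> {set X * X};
  (* inter_num i j k is p_{i,j}^k *)
  inter_num : 'I_d.+1 -> 'I_d.+1 -> 'I_d.+1 -> nat;
  scheme_inj : injective scheme_rel;
  scheme_partition : partition [set scheme_rel i | i : 'I_d.+1] [set: X * X];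
  scheme_diag : scheme_rel ord0 = [set p | p.1 == p.2];
  scheme_sym : forall i x y,
    ((x, y) \in scheme_rel i) = ((y, x) \in scheme_rel i);
  scheme_mul : forall i j,
    adjacency (scheme_rel i) *m adjacency (scheme_rel j) =
    \sum_k (inter_num i j k)%:Z *: adjacency (scheme_rel k)
}.

End Schemes.

(* Designs without repeated blocks; for lambda = 1 and t <= k repetition is
   impossible anyway. *)
Definition is_design (t v k lambda : nat) (P : finType)
    (D : {set {set P}}) : Prop :=
  [/\ #|P| = v,
      forall B, B \in D -> #|B| = k &
      forall T : {set P}, #|T| = t ->
        #|[set B in D | T \subset B]| = lambda].

Definition block (P : finType) (D : {set {set P}}) := {B : {set P} | B \in D}.

Definition block_rel (P : finType) (D : {set {set P}}) (i : 'I_4)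
    (B B' : block D) : bool :=
  if i == ord0 then B == B'
  else (B != B') && (#|val B :&: val B'| == 4 - i)%N.

(* The sequence indexed by i lists, for k = 0, 1, 2, 3, the row
   (p_{i,0}^k, p_{i,1}^k, p_{i,2}^k, p_{i,3}^k). *)
Definition witt_inter_table : seq (seq (seq nat)) :=
  [:: [:: [:: 1; 0; 0; 0]; [:: 0; 1; 0; 0]; [:: 0; 0; 1; 0]; [:: 0; 0; 0; 1]];
      [:: [:: 0; 30; 0; 0]; [:: 1; 15; 10; 4];
          [:: 0; 15; 6; 9]; [:: 0; 8; 12; 10]];
      [:: [:: 0; 0; 20; 0]; [:: 0; 10; 4; 6];
          [:: 1; 6; 10; 3]; [:: 0; 12; 4; 4]];
      [:: [:: 0; 0; 0; 15]; [:: 0; 4; 6; 5];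
          [:: 0; 9; 3; 3]; [:: 1; 10; 4; 0]]]%N.

Definition witt_inter_num (i j k : 'I_4) : nat :=
  nth 0%N (nth [::] (nth [::] witt_inter_table i) k) j.

Local Close Scope ring_scope.

(* A concrete 4-(11,5,1) design, showing that is_design 4 11 5 1 is
   satisfiable: the translates modulo 11 of six base blocks. *)
Definition witt_base : seq (seq nat) :=
  [:: [:: 0; 1; 2; 3; 5]; [:: 0; 1; 2; 6; 9]; [:: 0; 1; 2; 7; 8];
      [:: 0; 1; 3; 4; 7]; [:: 0; 1; 3; 6; 8]; [:: 0; 1; 5; 7; 9]]%N.

Definition witt_blocks : seq (seq nat) :=
  [seq sort leq [seq (x + c) %% 11 | x <- b] | b <- witt_base, c <- iota 0 11]%N.

Definition witt_set (s : seq nat) : {set 'I_11} := [set i | val i \in s].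

Definition witt_model : {set {set 'I_11}} := [set:: map witt_set witt_blocks].

Fixpoint increasing_seqs (n m k : nat) : seq (seq nat) :=
  match k, n with
  | 0, _ => [:: [::]]
  | k'.+1, 0 => [::]
  | k'.+1, n'.+1 =>
      map (cons m) (increasing_seqs n' m.+1 k') ++ increasing_seqs n' m.+1 k
  end%N.

Lemma mem_increasing_seqs n m k s :
  sorted ltn s -> size s = k -> all (fun x => m <= x < m + n)%N s ->
  s \in increasing_seqs n m k.
Proof.
elim: n m k s => [|n IHn] m [|k] [|x s] //=.
  by move=> _ _; rewrite addn0 ltnNge andbN.
move=> xs [sz_s] /andP[/andP[le_mx lt_x] /allP sP].
have gt_x: all (fun y => x < y)%N s by apply: order_path_min xs => y z t; apply: ltn_trans.
rewrite mem_cat; case: (ltngtP m x) le_mx => // [lt_mx | eq_mx] _; apply/orP.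
  right; apply: IHn => //=; first by rewrite sz_s.
  rewrite lt_mx addSnnS lt_x /=; apply/allP => y ys /=.
  by case/andP: (sP y ys) => _ ->; rewrite (ltn_trans lt_mx (allP gt_x y ys)).
left; rewrite eq_mx; apply: map_f; apply: IHn (path_sorted xs) sz_s _.
apply/allP => y ys /=; rewrite (allP gt_x y ys) /= addSnnS -eq_mx.
by case/andP: (sP y ys).
Qed.

Definition witt_elems (A : {set 'I_11}) : seq nat := map val (enum A).

Lemma witt_elems_increasing k (A : {set 'I_11}) :
  #|A| = k -> witt_elems A \in increasing_seqs 11 0 k.
Proof.
move=> cardA; apply: mem_increasing_seqs.
- rewrite /witt_elems {1}/enum_mem -enumT.
  apply: (subseq_sorted ltn_trans (s2 := map val (enum 'I_11))).
    by rewrite map_subseq // filter_subseq.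
  by rewrite val_enum_ord iota_ltn_sorted.
- by rewrite size_map -cardE.
- by apply/allP => x /mapP[i _ ->]; rewrite ltn_ord.
Qed.

Lemma witt_set_sub (A : {set 'I_11}) s :
  (A \subset witt_set s) = all (mem s) (witt_elems A).
Proof.
rewrite all_map; apply/subsetP/allP => sub x xA.
  by have := sub x; rewrite -mem_enum xA inE => /(_ isT).
by rewrite inE; apply: sub; rewrite mem_enum.
Qed.

Lemma witt_set_inj : {in witt_blocks &, injective witt_set}.
Proof.
have wfP: all (fun s => (sorted ltn s) && all (gtn 11) s) witt_blocks.
  by vm_compute.
move=> s t /(allP wfP)/andP[s_lt /allP s11] /(allP wfP)/andP[t_lt /allP t11] eq_st.
apply: (irr_sorted_eq ltn_trans ltnn) => // x.
case: (ltnP x 11) => [x11 | lex].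
  by have /setP/(_ (Ordinal x11)) := eq_st; rewrite !inE.
by apply/idP/idP => [/s11 | /t11] /=; rewrite ltnNge lex.
Qed.

Lemma witt_model_design : is_design 4 11 5 1 witt_model.
Proof.
split=> [|B|T card_T]; first exact: card_ord.
  rewrite inE => /mapP[s s_blk ->].
  have /allP/(_ s s_blk)/andP[s_sz /andP[s_uniq s11]]:
    all (fun s => (size s == 5) && (uniq s && all (gtn 11) s)) witt_blocks.
    by vm_compute.
  have sz_pmap: size (pmap insub s : seq 'I_11) = 5.
    rewrite size_pmap_sub; move: s11; rewrite all_count => /eqP->.
    exact/eqP.
  apply: etrans sz_pmap; rewrite -(card_uniqP _) ?pmap_sub_uniq //.
  by apply: eq_card => i; rewrite inE mem_pmap_sub.
have count1: count (fun s => all (mem s) (witt_elems T)) witt_blocks = 1%N.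
  have steiner: all (fun t => count (fun s => all (mem s) t) witt_blocks == 1)
                    (increasing_seqs 11 0 4) by vm_compute.
  exact/eqP/(allP steiner _ (witt_elems_increasing card_T)).
have blocks_uniq : uniq witt_blocks by vm_compute.
have ->: [set B in witt_model | T \subset B] =
         [set:: map witt_set
                  [seq s <- witt_blocks | all (mem s) (witt_elems T)]].
  apply/setP => B; rewrite 2![in LHS]inE [RHS]inE; apply/idP/idP.
    case/andP=> /mapP[s s_blk ->]; rewrite witt_set_sub => sT.
    by rewrite map_f // mem_filter sT.
  case/mapP=> s; rewrite mem_filter => /andP[sT s_blk] ->.
  by rewrite witt_set_sub sT map_f.
rewrite cardsE (card_uniqP _) ?size_map ?size_filter //.
rewrite map_inj_in_uniq ?filter_uniq // => s t.
by rewrite !mem_filter => /andP[_ s_blk] /andP[_ t_blk]; apply: witt_set_inj.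
Qed.

(* Main.v *)
(* Relation 2 is a strongly regular graph with the parameters of T(12), hence is
   T(12): the neighbourhood of a vertex has no 3-coclique and therefore splits
   into two 10-cliques, so every vertex is the pair of 11-cliques through it.

   The matrix with entries 30, 8, -3, -14 on the four relations is 198 times a
   projection of rank 10. The 11 vertices of an 11-clique K form a regular simplex
   in that eigenspace, so they are a tight frame of it, and each inner product is
   recovered from the inner products with K. With respect to the clique labelled 0,
   the pair {b, c} of the other labels becomes a row of signs on the labels
   d <> 0, b, c (negative when {0, d} and {b, c} are in relation 3) with three
   negative entries, and two rows differ in 4 places if their pairs meet, in 2 or
   5 places if the pairs are disjoint and in relation 1 or 3.

   A small exhaustive search shows that these rows are unique up to relabelling:
   the 12 labels are the rows of a Hadamard matrix of order 12 with constant first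
   column, a vertex is a pair of rows, and its block is the set of the other
   columns where both rows agree. A second search of the same kind shows that a
   4-(11,5,1) design is unique, hence isomorphic to the one just found. *)

Require Import Defs.
From mathcomp Require Import all_boot all_order all_algebra ring zify.

Set Implicit Arguments.
Unset Strict Implicit.
Unset Printing Implicit Defensive.

(** * Finite search and the explicit model *)

Section Search.
Variables (A : eqType) (compat : A -> A -> bool) (leaf : seq A -> bool).

(* Values incompatible with a choice are removed at once, so a branch with an
   empty domain is closed (and counts as successful). *)
Fixpoint search (n : nat) (acc : seq A) (doms : seq (seq A)) : bool :=
  match n, doms with
  | _, [::] => leaf acc
  | n'.+1, dom :: doms' =>
      all (fun a => let ds := [seq [seq b <- d | compat a b] | d <- doms'] in
                    has (@nilp A) ds || search n' (a :: acc) ds) dom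
  | 0, _ => false
  end.

(** Along an actual solution no domain ever becomes empty: its remaining entries are compatible with
    the choices made, so they survive every filter. The leaf receives the choices in reverse order,
    whence [catrev]. *)
Lemma searchP n acc doms sol :
  search n acc doms -> all2 (fun a d => a \in d) sol doms ->
  pairwise compat sol -> leaf (catrev sol acc).
Proof.
elim: n acc doms sol => [|n IHn] acc [|d ds] [|a sol] //= /allP srch.
move=> /andP[ad sol_ds] /andP[/allP a_sol sol_sol].
have sol_ds': all2 (fun a d => a \in d) sol
                [seq [seq b <- e | compat a b] | e <- ds].
  elim: sol ds {srch sol_sol} sol_ds a_sol => [|b s IHs] [|e ds] //=.
  case/andP=> be s_ds ab; rewrite mem_filter be ab ?mem_head //=.
  by apply: IHs => // c cs; apply: ab; rewrite inE cs orbT.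
case/orP: (srch a ad) => [|{}srch]; last exact: (IHn (a :: acc) _ sol srch).
move=> no_sol; suff: false by []; move: no_sol.
elim: sol {IHn srch sol_sol a_sol sol_ds} (map _ ds) sol_ds' => [|b s IHs] [|e es] //=.
by case/andP=> be s_es /orP[|/(IHs _ s_es)//]; case: e be.
Qed.
End Search.

Definition bits (n : nat) (s : seq nat) : bitseq := [seq i \in s | i <- iota 0 n].

(* Any two rows agree in exactly 5 positions; the 66 agreement sets are the blocks
   of a Witt design on 0, ..., 10. *)
Definition hadamard_rows : seq bitseq :=
  map (bits 11)
  [:: iota 0 11; [:: 1; 3; 4; 5; 10]; [:: 2; 4; 5; 6; 9]; [:: 3; 6; 8; 9; 10];
      [:: 0; 1; 2; 9; 10]; [:: 1; 2; 3; 6; 7]; [:: 0; 1; 4; 6; 8];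
      [:: 1; 5; 7; 8; 9]; [:: 0; 2; 3; 5; 8]; [:: 0; 3; 4; 7; 9];
      [:: 0; 5; 6; 7; 10]; [:: 2; 4; 7; 8; 10]].

Definition agreement (s t : bitseq) : bitseq := [seq p.1 == p.2 | p <- zip s t].
Definition overlap (s t : bitseq) : nat := count (fun p => p.1 && p.2) (zip s t).

Definition model_block (i j : nat) : bitseq :=
  agreement (nth [::] hadamard_rows i) (nth [::] hadamard_rows j).

Definition pairs (s : seq nat) : seq (nat * nat) :=
  [seq p <- [seq (i, j) | i <- s, j <- s] | p.1 < p.2].

Definition model_blocks : seq bitseq :=
  [seq model_block p.1 p.2 | p <- pairs (iota 0 12)].

(** The pair is stored with its row because [row_compat] treats pairs that meet differently from
    disjoint ones. *)
Definition sign_row := ((nat * nat) * seq (option bool))%type.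

(* The row of the pair {b, c} in the star of 0: entry d is None if {0, d} meets
   {b, c}, and otherwise tells whether {0, d} and {b, c} are in relation 3. *)
Definition row_of (sig : nat -> nat -> nat -> nat -> bool) (p : nat * nat) : sign_row :=
  (p, [seq (if (d == p.1) || (d == p.2) then None else Some (sig 0 d p.1 p.2))
       | d <- iota 1 11]).

Definition differ (a b : option bool) : bool :=
  match a, b with Some x, Some y => x (+) y | _, _ => false end.

Definition distance (s t : seq (option bool)) : nat :=
  count (fun p => differ p.1 p.2) (zip s t).

Definition meet (p q : nat * nat) : bool :=
  [|| p.1 == q.1, p.1 == q.2, p.2 == q.1 | p.2 == q.2].

Definition row_compat (r r' : sign_row) : bool :=
  let d := distance r.2 r'.2 in
  if meet r.1 r'.1 then d == 4 else (d == 2) || (d == 5).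

Definition mark (p : nat * nat) (s : seq nat) : sign_row :=
  (p, [seq (if (d == p.1) || (d == p.2) then None else Some (d \in s)) | d <- iota 1 11]).

Definition row_domain (p : nat * nat) : seq sign_row :=
  [seq mark p s | s <- increasing_seqs 11 1 3 & (p.1 \notin s) && (p.2 \notin s)].

(* Normal form of a labelling 0, 1, ..., 11: an entry (c, t) says that the row of
   the pair {1, c} is negative exactly on t. *)
Definition fixed_rows : seq (nat * seq nat) :=
  [:: (2, [:: 3; 4; 5]); (3, [:: 2; 6; 7]); (4, [:: 2; 8; 9]); (5, [:: 2; 10; 11])].

(** [pairs] is in lexicographic order, so the four pairs dropped are {1, 2}, ..., {1, 5}, whose rows
    the normal form prescribes. *)
Definition row_doms : seq (seq sign_row) :=
  [seq [:: mark (1, r.1) r.2] | r <- fixed_rows] ++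
  [seq row_domain p | p <- drop 4 (pairs (iota 1 11))].

(** Meeting in one point is relation 3 of the Witt scheme. *)
Definition model_rel (i j k l : nat) : bool :=
  overlap (model_block i j) (model_block k l) == 1.

(* The search leaves eight labellings, which differ by swaps inside the pairs
   {6, 7}, {8, 9}, {10, 11} left unordered by the normal form. *)
Definition relabellings : seq (seq nat) :=
  [seq iota 0 6 ++ s | s <- [seq a ++ b | a <- [:: [:: 6; 7]; [:: 7; 6]],
    b <- [seq b ++ c | b <- [:: [:: 8; 9]; [:: 9; 8]], c <- [:: [:: 10; 11]; [:: 11; 10]]]]].

Definition relabel (s : seq nat) (r : nat -> nat -> nat -> nat -> bool) i j k l :=
  r (nth 0 s i) (nth 0 s j) (nth 0 s k) (nth 0 s l).

Definition model_rows (s : seq nat) : seq sign_row :=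
  [seq row_of (relabel s model_rel) p | p <- pairs (iota 1 11)].

Definition row_leaf (acc : seq sign_row) : bool :=
  has (fun s => acc == rev (model_rows s)) relabellings.

(** The depth 55 is the number of pairs of labels other than 0. *)
Lemma row_search : search row_compat row_leaf 55 [::] row_doms.
Proof. by vm_compute. Qed.

(** The rows record only relations with pairs through 0. A relation between disjoint pairs avoiding
    0 has to be recovered from the distance of their rows, which is 5 exactly for relation 3; the
    models obey the same rule. *)
Lemma model_rows_distance :
  all (fun s => all (fun p => all (fun q => meet p.1 q.1 ||
     ((distance p.2 q.2 == 5) == relabel s model_rel p.1.1 p.1.2 q.1.1 q.1.2))
      (model_rows s)) (model_rows s)) relabellings.
Proof. by vm_compute. Qed.

(** Distinct blocks never share four points. Equality is allowed because several quadruples span the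
    same block. *)
Definition block_compat (s t : bitseq) : bool := (s == t) || (overlap s t <= 3).

Definition block_domain (s : seq nat) : seq bitseq :=
  [seq bits 11 (x :: s) | x <- iota 0 11 & x \notin s].

(* Normal form of a numbering 0, ..., 10 of the points of a Witt design. *)
Definition first_blocks : seq (seq nat) :=
  [:: [:: 0; 1; 2; 9; 10]; [:: 0; 1; 2; 7; 8]; [:: 0; 1; 3; 5; 7];
      [:: 0; 1; 2; 5; 6]; [:: 0; 1; 2; 3; 4]].

(* Every block has four of its points among 0, ..., 9. *)
Definition block_doms : seq (seq bitseq) :=
  [seq [:: bits 11 t] | t <- first_blocks] ++ map block_domain (increasing_seqs 10 0 4).

(** Each list s sends point j of a design reached by the search to point s_j of the model. *)
Definition point_relabellings : seq (seq nat) :=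
  [seq iota 0 5 ++ s | s <-
    [:: [:: 5; 6; 7; 8; 9; 10]; [:: 5; 6; 7; 8; 10; 9]; [:: 6; 5; 10; 9; 7; 8];
        [:: 6; 5; 10; 9; 8; 7]; [:: 7; 8; 5; 6; 9; 10]; [:: 7; 8; 5; 6; 10; 9];
        [:: 8; 7; 9; 10; 5; 6]; [:: 8; 7; 9; 10; 6; 5]; [:: 9; 10; 8; 7; 5; 6];
        [:: 9; 10; 8; 7; 6; 5]; [:: 10; 9; 6; 5; 7; 8]; [:: 10; 9; 6; 5; 8; 7]]].

(** The comparison is one of sets, since [acc] lists blocks with repetitions. *)
Definition block_leaf (acc : seq bitseq) : bool :=
  has (fun s => let m := [seq [seq nth false b i | i <- s] | b <- model_blocks] in
     all (mem m) acc && all (mem acc) m) point_relabellings.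

(** The depth is 215 = 5 + 210: the five prescribed blocks, then one block for each quadruple of 0,
    ..., 9. *)
Lemma block_search : search block_compat block_leaf 215 [::] block_doms.
Proof. by vm_compute. Qed.

(** * The triangular graph T(12) *)

Section Triangular.
Variables (X : finType) (e : rel X).

Definition nbh (x : X) : {set X} := [set y | e x y].

Hypotheses (e_irr : irreflexive e) (e_sym : symmetric e) (cardX : #|X| = 66).
Hypothesis card_nbh : forall x, #|nbh x| = 20.
Hypothesis card_nbh_adj : forall x y, e x y -> #|nbh x :&: nbh y| = 10.
Hypothesis card_nbh_nonadj :
  forall x y, x != y -> ~~ e x y -> #|nbh x :&: nbh y| = 4.

(* Inclusion-exclusion: three sets of size 10 with pairwise intersections of size
   at most 3 do not fit into 17 points. *)
Lemma no_local_coclique x y z w :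
  e x y -> e x z -> e x w -> uniq [:: y; z; w] ->
  ~~ e y z -> ~~ e y w -> ~~ e z w -> False.
Proof.
move=> xy xz xw; rewrite /= !inE negb_or -andbA => /and4P[yz yw zw _] nyz nyw nzw.
(* Of the four common neighbours of u and v, one is x itself, which is not in [nbh x]. *)
have cap u v : e x u -> e x v -> u != v -> ~~ e u v ->
    #|(nbh x :&: nbh u) :&: (nbh x :&: nbh v)| <= 3.
  move=> xu xv uv nuv; rewrite -ltnS -[4](card_nbh_nonadj uv nuv).
  apply/proper_card/properP; split.
    by apply/subsetP => t; rewrite !inE => /andP[/andP[_ ->] /andP[_ ->]].
  by exists x; rewrite !inE ?e_irr // e_sym xu e_sym xv.
set A := nbh x :&: nbh y; set B := nbh x :&: nbh z; set C := nbh x :&: nbh w.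
have sub : A :|: B :|: C \subset nbh x :\: [set y; z; w].
  apply/subsetP => t; rewrite !inE !negb_or => tABC.
  have xt : e x t by case/orP: tABC => [/orP[]|] /andP[].
  rewrite xt andbT; move: tABC; rewrite xt /=.
  rewrite -andbA; case: (eqVneq t y) => [->|_].
    by rewrite e_irr (e_sym z) (e_sym w) (negPf nyz) (negPf nyw).
  case: (eqVneq t z) => [->|_].
    by rewrite e_irr (e_sym w) (negPf nyz) (negPf nzw).
  by case: (eqVneq t w) => [->|//]; rewrite e_irr (negPf nyw) (negPf nzw).
have := subset_leq_card sub; rewrite cardsD card_nbh.
have -> : nbh x :&: [set y; z; w] = [set y; z; w].
  by apply/setIidPr/subsetP => t; rewrite !inE => /orP[/orP[]|] /eqP->.
have -> : #|[set y; z; w]| = 3.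
  by rewrite -setUA cardsU1 cards2 !inE negb_or yz yw zw.
have := cardsUI A B; have := cardsUI (A :|: B) C; rewrite setIUl.
have := cardsUI (A :&: C) (B :&: C).
have := cap _ _ xy xz yz nyz; have := cap _ _ xy xw yw nyw.
have := cap _ _ xz xw zw nzw; rewrite -/A -/B -/C.
move: (card_nbh_adj xy) (card_nbh_adj xz) (card_nbh_adj xw).
rewrite -/A -/B -/C; clearbody A B C; clear; lia.
Qed.

(** For x = {a, b} and y = {a, c} in T(12), these are the nine pairs {b, d} with d outside {a, b,
    c}: all but one of the vertices other than x in the star of b. *)
Definition far (x y : X) : {set X} := nbh x :\: nbh y :\ y.

Lemma in_far x y z : (z \in far x y) = [&& z != y, ~~ e y z & e x z].
Proof. by rewrite !inE. Qed.

Lemma card_far x y : e x y -> #|far x y| = 9.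
Proof.
move=> xy; have := cardsD1 y (nbh x :\: nbh y).
rewrite !inE e_irr xy cardsD card_nbh card_nbh_adj //= /far; lia.
Qed.

(** Two nonadjacent members would form a 3-coclique with y inside [nbh x]. *)
Lemma far_clique x y : e x y ->
  {in far x y &, forall u v, u != v -> e u v}.
Proof.
move=> xy u v; rewrite !in_far => /and3P[uy nyu xu] /and3P[vy nyv xv] uv.
apply/negPn/negP => nuv; apply: (no_local_coclique xy xu xv _ nyu nyv nuv).
by rewrite /= !inE negb_or ![y == _]eq_sym uy vy uv.
Qed.

(** With A = [far x y], the vertices y and A would exhaust the ten common neighbours of x with p and
    of x with q, while p, q and the rest of A would exhaust those of x with any a in A. A further
    neighbour b of x would then have its ten common neighbours with x among the 20 - 12 vertices of
    [nbh x] outside A and {b, p, q}. *)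
Lemma far_complete_uniq x y p q : e x y -> e x p -> e x q -> e y p -> e y q ->
  p != q -> {in far x y, forall a, e p a /\ e q a} -> False.
Proof.
move=> xy xp xq yp yq pq complete.
set A := far x y.
have pA : p \notin A by rewrite in_far yp andbF.
have qA : q \notin A by rewrite in_far yq andbF.
have yA : y \notin A by rewrite in_far eqxx.
have yp_neq : y != p by apply: contraTneq yp => <-; rewrite e_irr.
have yq_neq : y != q by apply: contraTneq yq => <-; rewrite e_irr.
have cardA : #|A| = 9 by apply: card_far.
have subA : A \subset nbh x by apply/subsetP => a; rewrite in_far inE => /and3P[].
have sub_nbh : p |: (q |: A) \subset nbh x.
  by rewrite !subUset !sub1set !inE xp xq.
have cardpqA : #|p |: (q |: A)| = 11.
  by rewrite !cardsU1 !in_setU1 (negPf pq) (negPf pA) qA cardA.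
have nbr r : r \in [set p; q] -> nbh x :&: nbh r = y |: A.
  rewrite !inE => rpq; apply/esym/eqP; rewrite eqEcard cardsU1 yA cardA.
  have [xr yr] : e x r /\ e y r by case/orP: rpq => /eqP->.
  rewrite card_nbh_adj // leqnn andbT subUset sub1set subsetI subA /=.
  rewrite inE [_ \in nbh x]inE xy inE e_sym yr; apply/subsetP => a aA.
  by rewrite inE; have [] := complete a aA; case/orP: rpq => /eqP->.
have nbrA a : a \in A -> nbh x :&: nbh a = p |: (q |: A :\ a).
  move=> aA; apply/esym/eqP; rewrite eqEcard.
  have [pa qa] := complete a aA.
  rewrite card_nbh_adj; last by move/(subsetP subA): aA; rewrite inE.
  have cAa : #|A :\ a| = 8 by apply/eqP; rewrite -eqSS -cardA (cardsD1 a A) aA.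
  have pAa : p \notin A :\ a by apply: contraNN pA => /setD1P[].
  have qAa : q \notin A :\ a by apply: contraNN qA => /setD1P[].
  rewrite !cardsU1 in_setU1 (negPf pq) (negPf pAa) qAa.
  rewrite cAa andbT.
  rewrite !subUset !sub1set !inE xp xq /= e_sym pa e_sym qa /=.
  apply/subsetP => u; rewrite in_setD1 => /andP[ua uA].
  rewrite in_setI (subsetP subA) // inE.
  by apply: (far_clique xy) => //; rewrite eq_sym.
have [b] : exists b, b \in nbh x :\: (y |: (p |: (q |: A))).
  apply/set0Pn; rewrite -card_gt0 cardsD card_nbh subn_gt0.
  apply: leq_ltn_trans (subset_leq_card (subsetIr _ _)) _.
  by rewrite cardsU1 cardpqA !in_setU1 !negb_or yp_neq yq_neq yA.
rewrite in_setD !in_setU1 !negb_or => /andP[/and4P[b_y bp bq bA] xb].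
have : nbh x :&: nbh b \subset nbh x :\: (b |: (p |: (q |: A))).
  apply/subsetP => t; rewrite in_setI in_setD => /andP[xt bt]; rewrite xt andbT.
  rewrite inE e_sym in bt; rewrite !in_setU1; apply/negP.
  have b_nbh r : e r b -> b \in nbh x :&: nbh r.
    by rewrite in_setI xb inE.
  case/or4P => [/eqP tE|/eqP tE|/eqP tE|tA].
  - by rewrite tE e_irr in bt.
  - have := b_nbh t bt; rewrite nbr; last by rewrite tE set21.
    by rewrite in_setU1 (negPf b_y) (negPf bA).
  - have := b_nbh t bt; rewrite nbr; last by rewrite tE set22.
    by rewrite in_setU1 (negPf b_y) (negPf bA).
  - have := b_nbh t bt; rewrite nbrA // !in_setU1 in_setD1.
    by rewrite (negPf bp) (negPf bq) (negPf bA) andbF.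
move/subset_leq_card; rewrite card_nbh_adj; last by rewrite inE in xb.
rewrite cardsDS; last by rewrite subUset sub1set xb.
by rewrite card_nbh cardsU1 !in_setU1 (negPf bp) (negPf bq) (negPf bA) cardpqA.
Qed.

(** If r misses some a in [far x y], then a is adjacent to the rest of both cliques [far x y] and
    [far x r], so 8 plus the size of [far x r :&: far x z] is at most 10. If r missed a vertex on
    both sides, the 9 vertices of [far x r] would meet the 18 of [far x y :|: far x z] in at most 4,
    although all of them lie among the 19 vertices of [nbh x :\ r]. *)
Lemma far_or_complete x y z r : e x y -> e x z -> y != z -> ~~ e y z ->
    e x r -> e y r -> e z r ->
  {in far x y, forall a, e r a} \/ {in far x z, forall b, e r b}.
Proof.
move=> xy xz yz nyz xr yr zr.
have bound u v : e x u -> e x v -> u != v -> ~~ e u v -> e u r ->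
    [exists a in far x u, ~~ e r a] -> #|far x r :&: far x v| <= 2.
  move=> xu xv uv nuv ur /exists_inP[a a_u nra].
  have xa : e x a by move: a_u; rewrite in_far => /and3P[].
  have disj w : w \in far x u -> w \in far x v -> False.
    rewrite !in_far => /and3P[wu nuw xw] /and3P[wv nvw _].
    apply: (no_local_coclique xu xv xw _ nuv nuw nvw).
    by rewrite /= !inE negb_or uv ![_ == w]eq_sym wu wv.
  have sub : far x u :\ a :|: far x r :&: far x v \subset nbh x :&: nbh a.
    apply/subsetP => w; rewrite in_setU in_setD1 in_setI.
    case/orP => [/andP[wa wu] | /andP[wr wv]].
      rewrite in_setI !inE; apply/andP; split.
        by move: wu; rewrite in_far => /and3P[].
      by apply: (far_clique xu) => //; rewrite eq_sym.
    rewrite in_setI !inE; apply/andP; split.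
      by move: wr; rewrite in_far => /and3P[].
    apply: (far_clique xr) => //.
      rewrite in_far nra xa !andbT.
      by apply: contraTneq a_u => ->; rewrite in_far ur andbF.
    by apply/eqP => aw; case: (disj w); rewrite -?aw // aw.
  have := subset_leq_card sub; rewrite card_nbh_adj // cardsU.
  have -> : (far x u :\ a) :&: (far x r :&: far x v) = set0.
    apply/setP => w; rewrite !in_setI in_setD1 in_set0; apply/negP.
    by case/andP=> /andP[_ wu] /andP[_ wv]; apply: (disj w).
  have -> : #|far x u :\ a| = 8.
    by have := cardsD1 a (far x u); rewrite a_u card_far // => -[].
  by rewrite cards0 subn0 -[10]/(8 + 2) leq_add2l.
case: (boolP [exists a in far x y, ~~ e r a]) => [ex_y | ]; last first.
  by rewrite negb_exists_in => /forall_inP h; left=> a /h; rewrite negbK.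
case: (boolP [exists b in far x z, ~~ e r b]) => [ex_z | ]; last first.
  by rewrite negb_exists_in => /forall_inP h; right=> a /h; rewrite negbK.
have disj : far x y :&: far x z = set0.
  apply/setP => w; rewrite in_setI in_set0 !in_far; apply/negP.
  case/andP=> /and3P[wy nyw xw] /and3P[wz nzw _].
  apply: (no_local_coclique xy xz xw _ nyz nyw nzw).
  by rewrite /= !inE negb_or yz ![_ == w]eq_sym wy wz.
have cardU : #|far x y :|: far x z| = 18.
  by rewrite cardsU disj cards0 !card_far.
have subU : far x y :|: far x z \subset nbh x :\ r.
  rewrite subUset; apply/andP; split; apply/subsetP => w; rewrite in_far => /and3P[_ nw xw].
    by rewrite !inE xw andbT; apply: contraNneq nw => ->.
  by rewrite !inE xw andbT; apply: contraNneq nw => ->.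
have c19 : #|nbh x :\ r| = 19.
  by have := cardsD1 r (nbh x); rewrite inE xr card_nbh => -[].
have sub_r : far x r \subset nbh x :\ r.
  by apply/subsetP => w; rewrite in_far !inE => /and3P[-> _ ->].
have capz : #|far x r :&: far x y| <= 2.
  by apply: (bound z y xz xy _ _ zr ex_z); rewrite 1?eq_sym 1?e_sym.
have capy := bound _ _ xy xz yz nyz yr ex_y.
have : #|far x r| + #|far x y :|: far x z| <= 19 + (2 + 2).
  rewrite -cardsUI leq_add //.
    by rewrite -c19; apply: subset_leq_card; rewrite subUset sub_r subU.
  by rewrite setIUr; apply: leq_trans (leq_card_setU _ _) (leq_add capz capy).
by rewrite card_far // cardU.
Qed.

(** * Cliques of size 11 as labels *)

Definition is_clique (K : {set X}) : bool :=
  [forall u in K, forall v in K, (u != v) ==> e u v].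

Lemma is_cliqueP (K : {set X}) :
  reflect {in K &, forall u v, u != v -> e u v} (is_clique K).
Proof.
apply: (iffP forall_inP) => [h u v uK vK uv | h u uK].
  by have /forall_inP/(_ v vK) := h u uK; rewrite uv.
by apply/forall_inP => v vK; apply/implyP; apply: h.
Qed.

Lemma is_clique_setU1 x (K : {set X}) :
  is_clique K -> {in K, forall u, e x u} -> is_clique (x |: K).
Proof.
move=> /is_cliqueP Kc xK; apply/is_cliqueP => u v.
case/setU1P=> [->|uK] /setU1P[->|vK] uv; rewrite ?eqxx // in uv *.
- exact: xK.
- by rewrite e_sym xK.
- exact: Kc.
Qed.

(** For nonadjacent y and z in [nbh x], the disjoint 9-cliques [far x y] and [far x z] leave two
    vertices over. Each of these extends one of the cliques, and they cannot both extend the same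
    one. *)
Lemma nbh_two_cliques x : exists K1 K2 : {set X},
  [/\ K1 :|: K2 = nbh x, [disjoint K1 & K2], #|K1| = 10, #|K2| = 10
    & is_clique K1 && is_clique K2].
Proof.
have /card_gt0P[y] : 0 < #|nbh x| by rewrite card_nbh.
rewrite inE => xy; have /card_gt0P[z] : 0 < #|far x y| by rewrite card_far.
rewrite in_far => /and3P[zy nyz xz].
have yz : y != z by rewrite eq_sym.
set R := nbh x :\: (far x y :|: far x z).
have disj w : w \in far x y -> w \in far x z -> False.
  rewrite !in_far => /and3P[wy nyw xw] /and3P[wz nzw _].
  apply: (no_local_coclique xy xz xw _ nyz nyw nzw).
  by rewrite /= !inE negb_or yz ![_ == w]eq_sym wy wz.
have far_sub u : far x u \subset nbh x.
  by apply/subsetP => w; rewrite in_far inE => /and3P[].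
have cardR : #|R| == 2.
  rewrite cardsDS ?subUset ?far_sub // card_nbh cardsU !card_far //.
  rewrite (_ : far x y :&: far x z = set0) ?cards0 //; apply/setP => w.
  by rewrite in_setI in_set0; apply/negP => /andP[]; apply: disj.
have inR r : r \in R -> [/\ e x r, e y r, e z r, r \notin far x y & r \notin far x z].
  rewrite in_setD in_setU negb_or => /andP[/andP[ry rz] xr]; rewrite inE in xr.
  have yr : e y r.
    apply: contraNT ry => nyr; rewrite in_far nyr xr !andbT.
    by apply: contraNneq rz => ->; rewrite in_far yz xy e_sym nyz.
  split=> //; apply: contraNT rz => nzr; rewrite in_far nzr xr !andbT.
  by apply: contraNneq ry => ->; rewrite in_far zy xz nyz.
have /cards2P[p [q [pq RE]]] := cardR.
have [xp yp zp py pz] : [/\ e x p, e y p, e z p, p \notin far x y & p \notin far x z].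
  by apply: inR; rewrite RE set21.
have [xq yq zq qy qz] : [/\ e x q, e y q, e z q, q \notin far x y & q \notin far x z].
  by apply: inR; rewrite RE set22.
have coverR : nbh x = far x y :|: far x z :|: R.
  by rewrite /R setDE setUIr setUCr setIT (setUidPr _) // subUset !far_sub.
have build u v : {in far x y, forall a, e u a} -> {in far x z, forall a, e v a} ->
    R = [set u; v] -> u != v -> u \notin far x y -> u \notin far x z ->
    v \notin far x y -> v \notin far x z -> exists K1 K2 : {set X},
  [/\ K1 :|: K2 = nbh x, [disjoint K1 & K2], #|K1| = 10, #|K2| = 10
    & is_clique K1 && is_clique K2].
  move=> uy vz RE' uv u_y u_z v_y v_z; exists (u |: far x y), (v |: far x z); split.
  - by rewrite coverR RE' setUACA setUC.
  - rewrite -setI_eq0; apply/eqP/setP => w; rewrite in_set0 in_setI !in_setU1.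
    apply/negP=> /andP[/orP[/eqP->|w_y] /orP[/eqP wE|w_z]].
    + by rewrite wE eqxx in uv.
    + by rewrite w_z in u_z.
    + by rewrite wE (negPf v_y) in w_y.
    + exact: disj w_y w_z.
  - by rewrite cardsU1 u_y card_far.
  - by rewrite cardsU1 v_z card_far.
  - by rewrite !is_clique_setU1 //; apply/is_cliqueP; apply: far_clique.
have [py'|pz'] := far_or_complete xy xz yz nyz xp yp zp;
have [qy'|qz'] := far_or_complete xy xz yz nyz xq yq zq.
- by case: (far_complete_uniq xy xp xq yp yq pq) => a ay; rewrite py' ?qy'.
- exact: (build p q).
- by apply: (build q p) => //; rewrite 1?setUC 1?eq_sym.
- by case: (far_complete_uniq xz xp xq zp zq pq) => a az; rewrite pz' ?qz'.
Qed.

(** In T(12) these are the stars of the twelve labels, so they will stand for the labels. *)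
Definition grand : {set {set X}} := [set K : {set X} | (#|K| == 11) && is_clique K].

(** A vertex of K1 shares with x the nine other vertices of K1, hence at most one vertex of K2. An
    11-clique through x that met both K1 and K2 would therefore have at most two vertices besides
    x. *)
Lemma grand_through x : exists M1 M2 : {set X},
  [/\ [set M in grand | x \in M] = [set M1; M2], M1 != M2, M1 :&: M2 = [set x]
    & x |: nbh x = M1 :|: M2].
Proof.
have [K1 [K2 [KU Kdisj c1 c2 /andP[cl1 cl2]]]] := nbh_two_cliques x.
have xN : x \notin nbh x by rewrite inE e_irr.
have sub1 : K1 \subset nbh x by rewrite -KU subsetUl.
have sub2 : K2 \subset nbh x by rewrite -KU subsetUr.
have xK1 : x \notin K1 by apply: contra xN; apply: (subsetP sub1).
have xK2 : x \notin K2 by apply: contra xN; apply: (subsetP sub2).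
have K12 : K1 :&: K2 = set0 by apply/eqP; rewrite setI_eq0.
have cap : (x |: K1) :&: (x |: K2) = [set x] by rewrite -setUIr K12 setU0.
have grandU (K : {set X}) : K \subset nbh x -> #|K| = 10 -> x \notin K -> is_clique K ->
    x |: K \in grand.
  move=> sK cK xK clK; rewrite inE cardsU1 xK cK is_clique_setU1 //.
  by move=> u /(subsetP sK); rewrite inE.
have cross (K L : {set X}) u : K \subset nbh x -> K :|: L = nbh x -> K :&: L = set0 -> #|K| = 10 ->
    is_clique K -> u \in K -> #|nbh u :&: L| <= 1.
  move=> sK KL KL0 cK /is_cliqueP clK uK.
  have xu : e x u by have := subsetP sK u uK; rewrite inE.
  have : K :\ u :|: nbh u :&: L \subset nbh x :&: nbh u.
    rewrite subUset !subsetI; apply/and3P; split.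
    - by apply/andP; split; [apply: subset_trans sK; apply: subsetDl |
        apply/subsetP => w /setD1P[wu wK]; rewrite inE clK // eq_sym].
    - by rewrite -KL; apply: subset_trans (subsetIr _ _) (subsetUr _ _).
    - exact: subsetIl.
  move/subset_leq_card; rewrite card_nbh_adj // cardsU.
  have -> : (K :\ u) :&: (nbh u :&: L) = set0.
    apply/eqP; rewrite -subset0 -KL0 setIA; apply: setSI.
    by apply: subset_trans (subsetIl _ _) (subsetDl _ _).
  have -> : #|K :\ u| = 9 by have := cardsD1 u K; rewrite uK cK => -[].
  by rewrite cards0 subn0 -[10]/(9 + 1) leq_add2l.
exists (x |: K1), (x |: K2); split=> //.
- apply/setP => M; rewrite !inE; apply/idP/idP; last first.
    case/orP => /eqP->; rewrite setU11 andbT.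
      by have := grandU K1 sub1 c1 xK1 cl1; rewrite inE.
    by have := grandU K2 sub2 c2 xK2 cl2; rewrite inE.
  move=> /andP[/andP[/eqP cM /is_cliqueP clM] xM].
  have MD : #|M :\ x| = 10 by have := cardsD1 x M; rewrite xM cM => -[].
  have Msub : M :\ x \subset K1 :|: K2.
    rewrite KU; apply/subsetP => u /setD1P[ux uM]; rewrite inE.
    by apply: clM; rewrite // eq_sym.
  have inter (K L : {set X}) u : K \subset nbh x -> K :|: L = nbh x -> K :&: L = set0 -> #|K| = 10 ->
      is_clique K -> u \in M :\ x -> u \in K -> #|(M :\ x) :&: L| <= 1.
    move=> sK KL KL0 cK clK /setD1P[ux uM] uK.
    apply: leq_trans (cross K L u sK KL KL0 cK clK uK).
    apply/subset_leq_card/subsetP => w; rewrite !in_setI in_setD1 inE.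
    case/andP=> /andP[wx wM] wL; rewrite wL andbT; apply: clM => //.
    apply: contraTneq wL => <-; apply/negP => uL.
    by have := in_set0 u; rewrite -KL0 in_setI uK uL.
  have MI : M :\ x = ((M :\ x) :&: K1) :|: ((M :\ x) :&: K2).
    by rewrite -setIUr (setIidPl Msub).
  have [e1|[u]] := set_0Vmem ((M :\ x) :&: K1); last first.
    case/setIP=> uM uK; have [e2|[v]] := set_0Vmem ((M :\ x) :&: K2); last first.
      case/setIP=> vM vK.
      have h2 := inter _ _ _ sub1 KU K12 c1 cl1 uM uK.
      have h1 : #|(M :\ x) :&: K1| <= 1.
        by apply: (inter K2 K1 v) => //; rewrite 1?setUC 1?setIC.
      have := leq_trans (leq_card_setU _ _) (leq_add h1 h2).
      by rewrite -MI MD.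
    rewrite e2 setU0 in MI; apply/orP; left; rewrite -(setD1K xM).
    apply/eqP; congr (_ |: _); apply/eqP; rewrite eqEcard c1 MD MI.
    by rewrite setIC; apply/andP; split; first exact: subsetIl.
  rewrite e1 set0U in MI; apply/orP; right; rewrite -(setD1K xM).
  apply/eqP; congr (_ |: _); apply/eqP; rewrite eqEcard c2 MD MI.
  by rewrite setIC; apply/andP; split; first exact: subsetIl.
- apply/eqP => E; have := c1; have : K1 \subset x |: K1 by apply: subsetUr.
  have := cap; rewrite -E setIid => -> /subset_leq_card.
  by rewrite cards1 => + c; rewrite c.
- by rewrite -KU setUUr.
Qed.
Lemma card_grand_through x : #|[set M in grand | x \in M]| = 2.
Proof. by have [M1 [M2 [-> neq _ _]]] := grand_through x; rewrite cards2 neq. Qed.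

Lemma grand_setI x (M M' : {set X}) : M \in grand -> M' \in grand -> M != M' ->
  x \in M -> x \in M' -> M :&: M' = [set x].
Proof.
move=> gM gM' neq xM xM'; have [M1 [M2 [E _ cap _]]] := grand_through x.
have : M \in [set M1; M2] by rewrite -E inE gM.
have : M' \in [set M1; M2] by rewrite -E inE gM'.
by rewrite !inE => /orP[] /eqP ? /orP[] /eqP ?; subst; rewrite ?eqxx // in neq *;
   rewrite 1?setIC.
Qed.

Lemma grand_adj x y : e x y -> exists M, [/\ M \in grand, x \in M & y \in M].
Proof.
move=> xy; have [M1 [M2 [E _ _ cover]]] := grand_through x.
have thr (M : {set X}) : M \in [set M1; M2] -> M \in grand /\ x \in M.
  by rewrite -E inE => /andP[].
have : y \in M1 :|: M2 by rewrite -cover !inE xy orbT.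
case/setUP => yM; [exists M1 | exists M2]; split=> //.
- by have [] := thr M1 (set21 _ _).
- by have [] := thr M1 (set21 _ _).
- by have [] := thr M2 (set22 _ _).
- by have [] := thr M2 (set22 _ _).
Qed.

(** Incidences are counted twice: 66 vertices lie in two cliques each, and each clique has 11
    vertices. *)
Lemma card_grand : #|grand| = 12.
Proof.
have : \sum_(M in grand) #|M| = \sum_x #|[set M in grand | x \in M]|.
  under eq_bigr => M _ do rewrite -sum1_card.
  under [RHS]eq_bigr => x _ do rewrite -sum1_card.
  rewrite (exchange_big_dep predT) //=; apply: eq_bigr => x _.
  by apply: eq_bigl => M; rewrite !inE.
rewrite (eq_bigr (fun=> 11)); last by move=> M; rewrite inE => /andP[/eqP].
under [RHS]eq_bigr => x _ do rewrite card_grand_through.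
by rewrite !sum_nat_const cardX => /eqP; rewrite (_ : 66 * 2 = 12 * 11) // eqn_pmul2r // => /eqP.
Qed.

(** Each of the 11 vertices of M lies in exactly one other such clique, and each of the 11 other
    cliques meets M at most once. The two counts agree only if every one of them meets M. *)
Lemma grand_meet (M M' : {set X}) : M \in grand -> M' \in grand -> M != M' ->
  exists x, M :&: M' = [set x].
Proof.
move=> gM gM' neq; case: (set_0Vmem (M :&: M')) => [E0|[x /setIP[xM xM']]]; last first.
  by exists x; apply: grand_setI.
have le1 (N : {set X}) : N \in grand :\ M -> #|M :&: N| <= 1.
  case/setD1P=> NM gN; case: (set_0Vmem (M :&: N)) => [->|[x /setIP[xM xN]]].
    by rewrite cards0.
  by rewrite (grand_setI gM gN _ xM xN) ?cards1 // eq_sym.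
have : \sum_(N in grand :\ M) #|M :&: N| = \sum_(x in M) 1.
  under eq_bigr => N _ do rewrite -sum1_card.
  rewrite (exchange_big_dep (mem M)) /=; last by move=> N x _ /setIP[].
  apply: eq_bigr => x xM; rewrite sum1_card.
  have := card_grand_through x.
  have MM : M \in [set N in grand | x \in N] by rewrite inE gM.
  rewrite (cardsD1 M) MM => -[<-].
  by apply: eq_card => N; rewrite unfold_in !inE xM -!andbA.
have MD : M' \in grand :\ M by rewrite in_setD1 eq_sym neq.
rewrite (bigD1 M') //= E0 cards0 add0n sum1_card.
have -> : #|M| = 11 by move: gM; rewrite inE => /andP[/eqP].
move=> E11; have : \sum_(N in grand :\ M | N != M') #|M :&: N| <=
    \sum_(N in grand :\ M | N != M') 1.
  by apply: leq_sum => N /andP[ND _]; apply: le1.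
rewrite E11 sum1_card => le11.
have := card_grand; rewrite (cardsD1 M) gM (cardsD1 M') MD !add1n => -[cN].
move: le11; rewrite (_ : #|_| = 10) //; apply: etrans cN.
by apply: eq_card => N; rewrite unfold_in !inE andbC.
Qed.

Theorem srg_triangular : exists pt : 'I_12 -> 'I_12 -> X,
  [/\ forall x, exists i j, i != j /\ x = pt i j,
      forall i j, pt i j = pt j i,
      forall i j k, uniq [:: i; j; k] -> e (pt i j) (pt i k) &
      forall i j k l, uniq [:: i; j; k; l] ->
        pt i j != pt k l /\ ~~ e (pt i j) (pt k l)].
Proof.
have /card_gt0P[x0 _] : 0 < #|X| by rewrite cardX.
pose q (i : 'I_12) : {set X} := enum_val (cast_ord (esym card_grand) i).
have q_grand i : q i \in grand by apply: enum_valP.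
have q_inj : injective q by move=> i j /enum_val_inj /cast_ord_inj.
have q_onto M : M \in grand -> exists i, q i = M.
  move=> gM; exists (cast_ord card_grand (enum_rank_in gM M)).
  by rewrite /q cast_ordK enum_rankK_in.
(* Off the diagonal this is the unique common vertex; on the diagonal it is an arbitrary vertex of
   the clique. *)
pose pt i j := odflt x0 [pick x in q i :&: q j].
have ptP i j : i != j -> q i :&: q j = [set pt i j].
  move=> ij; have [x E] : exists x, q i :&: q j = [set x].
    by apply: grand_meet; rewrite ?(inj_eq q_inj).
  rewrite /pt; case: pickP => [y|/(_ x)]; rewrite E ?inE ?eqxx // => /eqP-> //=.
have pt_l i j : i != j -> pt i j \in q i.
  by move=> /ptP E; have := set11 (pt i j); rewrite -E => /setIP[].
have ptC i j : pt i j = pt j i.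
  by rewrite /pt setIC.
have pt_r i j : i != j -> pt i j \in q j.
  by move=> ij; rewrite ptC pt_l // eq_sym.
have mem_pt i j k : i != j -> (pt i j \in q k) = (k == i) || (k == j).
  move=> ij; apply/idP/orP => [pk | [] /eqP->]; rewrite ?pt_l ?pt_r //.
  have := card_grand_through (pt i j).
  case: (eqVneq k i) => [|ki]; first by left.
  case: (eqVneq k j) => [|kj]; first by right.
  move=> c2; suff : #|[set q i; q j; q k]| <= 2.
    rewrite -setUA cardsU1 cards2 !inE !(inj_eq q_inj) negb_or ij.
    by rewrite ![_ == k]eq_sym ki kj.
  rewrite -c2; apply/subset_leq_card/subsetP => M.
  by case/setUP => [/set2P[]|/set1P] ->; rewrite inE q_grand ?pt_l ?pt_r.
exists pt; split=> //.
- move=> x; have [M1 [M2 [E neq cap _]]] := grand_through x.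
  have [[i iE] [j jE]] : (exists i, q i = M1) /\ (exists j, q j = M2).
    have : M1 \in [set M1; M2] := set21 _ _; have : M2 \in [set M1; M2] := set22 _ _.
    by rewrite -E => /setIdP[/q_onto ? _] /setIdP[/q_onto ? _].
  have ij : i != j by rewrite -(inj_eq q_inj) iE jE.
  by exists i, j; split=> //; apply/set1P; rewrite -ptP // iE jE cap set11.
- move=> i j k; rewrite /= !inE negb_or => /and3P[/andP[ij ik] jk _].
  have := q_grand i; rewrite inE => /andP[_ /is_cliqueP]; apply; rewrite ?pt_l //.
  apply/eqP => E; have := mem_pt i j k ij; rewrite E.
  by rewrite pt_r // ![k == _]eq_sym (negPf ik) (negPf jk).
move=> i j k l; rewrite /= !inE !negb_or -!andbA.
case/and5P=> ij ik il jk /and3P[jl kl _]; split.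
  apply/eqP => E; have := mem_pt i j k ij; rewrite E.
  by rewrite pt_l // ![k == _]eq_sym (negPf ik) (negPf jk).
apply/negP => /grand_adj[M [/q_onto[m <-]]]; rewrite !mem_pt // => /orP[] /eqP->.
  by rewrite (negPf ik) (negPf il).
by rewrite (negPf jk) (negPf jl).
Qed.

End Triangular.

(** * Counting in the scheme *)

Ltac distinct :=
  rewrite /= !inE ?negb_or -?andbA; repeat (apply/andP; split); by [|rewrite eq_sym].

(** The analogue of [distance] for rows taken in the star of an arbitrary label a. *)
Definition split_distance (T : finType) (sig : T -> T -> T -> T -> bool) a b c b' c' :=
  #|[set d | d \notin [:: a; b; c; b'; c'] & sig a d b c (+) sig a d b' c']|.

Lemma card_notin (T : finType) (s : seq T) :
  uniq s -> #|[set x | x \notin s]| = (#|T| - size s)%N.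
Proof.
move=> /card_uniqP <-; rewrite -(cardC (mem s)) addKn.
by apply: eq_card => x; rewrite !inE.
Qed.

Section SchemeCount.
Import Order.TTheory GRing.Theory Num.Theory.
Variables (X : finType) (S : symmetric_scheme 3 X).
Hypothesis hS : forall i j k : 'I_4, inter_num S i j k = witt_inter_num i j k.

Definition rel_index (x y : X) : 'I_4 :=
  odflt ord0 [pick i | (x, y) \in S i].

Lemma rel_indexE i x y : ((x, y) \in S i) = (rel_index x y == i).
Proof.
have /and3P[/eqP cov /trivIsetP triv _] := scheme_partition S.
have disj j k : (x, y) \in S j -> (x, y) \in S k -> j = k.
  move=> xj xk; apply: (@scheme_inj _ _ S); apply/eqP/negPn/negP => neq.
  have := triv (S j) (S k); rewrite !imset_f // => /(_ isT isT neq).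
  by move/pred0P/(_ (x, y)); rewrite /= xj xk.
have [j xj] : exists j, (x, y) \in S j.
  have : (x, y) \in cover [set S i | i : 'I_4] by rewrite cov inE.
  by case/bigcupP=> _ /imsetP[j _ ->]; exists j.
rewrite /rel_index; case: pickP => [k xk | /(_ j)]; last by rewrite xj.
by apply/idP/eqP => [xi | <- //]; apply: disj xk xi.
Qed.

Lemma rel_index_sym x y : rel_index x y = rel_index y x.
Proof. by apply/eqP; rewrite -rel_indexE scheme_sym rel_indexE. Qed.

Lemma rel_index_eq0 x y : (rel_index x y == ord0) = (x == y).
Proof. by rewrite -rel_indexE scheme_diag inE. Qed.

(** This is the entry at (x, y) of [scheme_mul], whose left side counts paths. *)
Lemma card_rel_path i j x y :
  #|[set z | (rel_index x z == i) && (rel_index z y == j)]| =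
  witt_inter_num i j (rel_index x y).
Proof.
have /matrixP/(_ (enum_rank x) (enum_rank y)) := scheme_mul S i j.
rewrite !mxE summxE; under eq_bigr => k _ do rewrite !mxE !enum_rankK !rel_indexE.
under [RHS]eq_bigr => k _ do rewrite !mxE !enum_rankK rel_indexE hS.
rewrite [RHS](bigD1 (rel_index x y)) //= eqxx mulr1 [X in (_ + X)%R]big1 ?addr0.
  rewrite (reindex_onto enum_rank enum_val); last by move=> k _; apply: enum_valK.
  under eq_bigl => z do rewrite enum_rankK eqxx.
  under eq_bigr => z _ do rewrite enum_rankK -natrM mulnb.
  rewrite -natr_sum -natz => /eqP; rewrite eqr_nat => /eqP <-.
  rewrite -sum1_card big_mkcond /=; apply: eq_bigr => z _.
  by rewrite inE; case: (_ && _).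
by move=> k; rewrite eq_sym => /negPf->; rewrite mulr0.
Qed.

Local Open Scope ring_scope.

(** Multiplication in the Bose-Mesner algebra: grouping z by its relations to x and y reduces the
    sum to the table. *)
Lemma sum_rel_path (F G : 'I_4 -> int) x y :
  \sum_z F (rel_index x z) * G (rel_index z y) =
  \sum_i \sum_j F i * G j * (witt_inter_num i j (rel_index x y))%:R.
Proof.
rewrite pair_big /= (partition_big (fun z => (rel_index x z, rel_index z y)) predT) //=.
apply: eq_bigr => -[i j] _ /=; rewrite -card_rel_path mulr_natr -sumr_const.
apply: eq_big => [z|z]; first by rewrite inE xpair_eqE.
by rewrite xpair_eqE => /andP[/eqP-> /eqP->].
Qed.

Lemma card_scheme : #|X| = 66%N.
Proof.
have /set0Pn[[x _] _] : S ord0 != set0.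
  have /and3P[_ _] := scheme_partition S; apply: contraNN => /eqP<-.
  exact: imset_f.
have := sum_rel_path (fun=> 1) (fun=> 1) x x.
rewrite (eqP (_ : rel_index x x == ord0)) ?rel_index_eq0 //.
rewrite mulr1 sumr_const => cardE; apply/eqP; rewrite -(eqr_nat int) cardE.
by rewrite !(big_ord_recl, big_ord0).
Qed.

(* 11 times the Gram matrix |B :&: B'| - 25/11 of the centred blocks. *)
Definition eigen (x y : X) : int := nth 0 [:: 30; 8; -3; -14] (rel_index x y).

Lemma eigen_sym x y : eigen x y = eigen y x.
Proof. by rewrite /eigen rel_index_sym. Qed.

Lemma eigen_diag x : eigen x x = 30.
Proof. by rewrite /eigen (eqP (_ : rel_index x x == ord0)) // rel_index_eq0. Qed.

(** Both sides depend only on the relation between x and y, so four numerical checks suffice. *)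
Lemma eigen_conv x y : \sum_z eigen x z * eigen z y = 198 * eigen x y.
Proof.
pose F (i : 'I_4) : int := nth 0 [:: 30; 8; -3; -14] i.
rewrite (sum_rel_path F F) /F /eigen.
by case: (rel_index x y) => [[|[|[|[|k]]]] //= lt_k]; rewrite !(big_ord_recl, big_ord0).
Qed.

(* The sum over x and y of the squared differences of both sides vanishes. *)
Lemma star_frame (I : finType) (A : {set I}) (w : I -> X) :
  #|A| = 11%N -> {in A &, forall i j, i != j -> eigen (w i) (w j) = -3} ->
  forall x y, \sum_(i in A) eigen x (w i) * eigen y (w i) = 33 * eigen x y.
Proof.
move=> cardA gram.
(* With 198 hidden behind N the sums below stay polynomial in N; the value enters only at the end,
   through the factor 198 - N. *)
have [N N198 conv] : exists2 N : int, N = 198 &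
    forall x y, \sum_z eigen x z * eigen z y = N * eigen x y.
  by exists 198 => //; apply: eigen_conv.
pose s x y := \sum_(i in A) eigen x (w i) * eigen y (w i).
have diag z : \sum_(y in [set: X]) (eigen z y) ^+ 2 = N * 30.
  rewrite -(eigen_diag z) -conv; apply: eq_big => [y|y _]; first by rewrite inE.
  by rewrite expr2 [X in _ * X]eigen_sym.
(* Summing over x and over y are two convolutions, which leave the squared entries of the Gram
   matrix of the 11 vertices: one 30 and ten -3 in each row. *)
have sum_ss : \sum_x \sum_y s x y ^+ 2 = N ^+ 2 * 11 * (30 ^+ 2 + 10 * 9).
  transitivity (\sum_(i in A) \sum_(j in A) (N * eigen (w i) (w j)) ^+ 2).
    under eq_bigr => x _ do under eq_bigr => y _ do
      rewrite expr2 /s big_distrlr /=.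
    under eq_bigr => x _ do rewrite exchange_big /=.
    rewrite exchange_big /=; apply: eq_bigr => i _.
    under eq_bigr => x _ do rewrite exchange_big /=.
    rewrite exchange_big /=; apply: eq_bigr => j _.
    rewrite -conv expr2 big_distrlr /=.
    apply: eq_bigr => x _; apply: eq_bigr => y _.
    by rewrite ![eigen (w i) _]eigen_sym; ring.
  rewrite (eq_bigr (fun=> N ^+ 2 * (30 ^+ 2 + 10 * 9))) => [|i iA].
    by rewrite sumr_const cardA -mulr_natr; ring.
  rewrite (bigD1 i) //= eigen_diag (eq_bigr (fun=> (N * -3) ^+ 2)) => [|j /andP[jA ji]].
    have card10 : #|A :\ i| = 10%N by have := cardsD1 i A; rewrite iA cardA => -[].
    rewrite (eq_bigl (mem (A :\ i))) => [|j]; last by rewrite !inE andbC.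
    by rewrite sumr_const card10 -mulr_natr; ring.
  by rewrite gram // eq_sym.
have sum_sf : \sum_x \sum_y s x y * eigen x y = N ^+ 2 * 11 * 30.
  transitivity (\sum_(i in A) \sum_x \sum_y eigen x (w i) * eigen y (w i) * eigen x y).
    under eq_bigr => x _ do under eq_bigr => y _ do rewrite /s mulr_suml.
    under eq_bigr => x _ do rewrite exchange_big /=.
    by rewrite exchange_big.
  rewrite (eq_bigr (fun=> N ^+ 2 * 30)) => [|i iA].
    by rewrite sumr_const cardA -mulr_natr; ring.
  transitivity (\sum_x N * (eigen (w i) x * eigen x (w i))).
    apply: eq_bigr => x _; transitivity (eigen x (w i) * \sum_y eigen x y * eigen y (w i)).
      by rewrite mulr_sumr; apply: eq_bigr => y _; ring.
    by rewrite conv [eigen (w i) x]eigen_sym; ring.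
  by rewrite -mulr_sumr conv eigen_diag; ring.
have sum_ff : \sum_x \sum_y eigen x y ^+ 2 = 66 * (N * 30).
  rewrite (eq_bigr (fun=> N * 30)) => [|x _]; first by rewrite sumr_const card_scheme -mulr_natr; ring.
  by rewrite -(diag x); apply: eq_bigl => y; rewrite inE.
have : \sum_x \sum_y (s x y - 33 * eigen x y) ^+ 2 = 0.
  transitivity (\sum_x \sum_y (s x y ^+ 2 + (-66) * (s x y * eigen x y) +
      33 ^+ 2 * eigen x y ^+ 2)).
    by apply: eq_bigr => x _; apply: eq_bigr => y _; ring.
  under eq_bigr => x _ do rewrite !big_split /= -!mulr_sumr.
  rewrite !big_split /= -!mulr_sumr sum_ss sum_sf sum_ff.
  transitivity (N * (11 * 30 * 33) * (198 - N)); first by ring.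
  by rewrite N198 subrr mulr0.
move/eqP; rewrite psumr_eq0 => [/allP zero x y|x _]; last first.
  by apply: sumr_ge0 => y _; apply: sqr_ge0.
have := zero x (mem_index_enum x); rewrite /= psumr_eq0 => [/allP zero_x|z _]; last exact: sqr_ge0.
by have := zero_x y (mem_index_enum y); rewrite /= sqrf_eq0 subr_eq0 => /eqP.
Qed.

Lemma card_rel_nbh i x : #|[set z | rel_index x z == i]| = witt_inter_num i i ord0.
Proof.
rewrite -(eqP (_ : rel_index x x == ord0)) ?rel_index_eq0 // -card_rel_path.
by apply: eq_card => z; rewrite !inE [rel_index z x]rel_index_sym andbb.
Qed.

(** Since p_{2,2}^1 = p_{2,2}^3 = 4, relation 2 is strongly regular with parameters (66, 20, 10,
    4). *)
Lemma scheme_pairs : exists pt : 'I_12 -> 'I_12 -> X,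
  [/\ forall x, exists i j, i != j /\ x = pt i j,
      forall i j, pt i j = pt j i,
      forall i j k, uniq [:: i; j; k] -> rel_index (pt i j) (pt i k) = 2%R &
      forall i j k l, uniq [:: i; j; k; l] ->
        rel_index (pt i j) (pt k l) = 1%R \/ rel_index (pt i j) (pt k l) = 3%R].
Proof.
pose e x y := rel_index x y == 2%R.
have nbhI x y : #|nbh e x :&: nbh e y| = witt_inter_num 2 2 (rel_index x y).
  rewrite -card_rel_path; apply: eq_card => z.
  by rewrite !inE /e [rel_index z y]rel_index_sym.
have [|x y||x|x y|x y|pt [onto sym adj nadj]] := @srg_triangular X e.
- by move=> x; rewrite /e (eqP (_ : rel_index x x == ord0)) ?rel_index_eq0.
- by rewrite /e rel_index_sym.
- exact: card_scheme.
- exact: card_rel_nbh.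
- by move=> /eqP xy; rewrite nbhI xy.
- rewrite -rel_index_eq0 nbhI /e.
  by case: (rel_index x y) => [[|[|[|[|k]]]]].
exists pt; split=> // [i j k /adj/eqP // | i j k l /nadj[]].
rewrite -rel_index_eq0 /e.
case: (rel_index _ _) => [[|[|[|[|m]]]] // lt_m] _ _; [left | right]; exact: val_inj.
Qed.

(** * Signs in the star of a label *)

Section Splits.
Variable pt : 'I_12 -> 'I_12 -> X.
Hypothesis pt_meet : forall i j k, uniq [:: i; j; k] ->
  rel_index (pt i j) (pt i k) = 2%R.
Hypothesis pt_disjoint : forall i j k l, uniq [:: i; j; k; l] ->
  rel_index (pt i j) (pt k l) = 1%R \/ rel_index (pt i j) (pt k l) = 3%R.
Hypothesis pt_sym : forall i j, pt i j = pt j i.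

Definition split_rel (i j k l : 'I_12) : bool := rel_index (pt i j) (pt k l) == 3%R.

Lemma eigen_meet i j k : uniq [:: i; j; k] -> eigen (pt i j) (pt i k) = -3.
Proof. by move=> u; rewrite /eigen pt_meet. Qed.

Lemma eigen_disjoint i j k l : uniq [:: i; j; k; l] ->
  eigen (pt i j) (pt k l) = 8 - 22 * (split_rel i j k l)%:R.
Proof. by move=> u; rewrite /eigen /split_rel; case: (pt_disjoint u) => ->. Qed.

Lemma star_eigen a x y :
  \sum_(d | d != a) eigen x (pt a d) * eigen y (pt a d) = 33 * eigen x y.
Proof.
rewrite -(@star_frame _ (setT :\ a) (pt a)).
- by apply: eq_bigl => d; rewrite !inE andbT.
- by have := cardsD1 a setT; rewrite cardsT card_ord inE => -[].
move=> i j; rewrite !inE !andbT => ia ja ij.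
by apply: eigen_meet; distinct.
Qed.

Lemma eigen_star a b c d : uniq [:: a; b; c] -> d != a ->
  eigen (pt b c) (pt a d) =
    if d \in [:: b; c] then -3 else 8 - 22 * (split_rel a d b c)%:R.
Proof.
rewrite /= !inE negb_or -andbA => /and4P[ab ac bc _] da.
rewrite eigen_sym.
case: eqVneq => [->|db] /=.
  by rewrite [pt a b]pt_sym eigen_meet //; distinct.
case: eqVneq => [->|dc] /=.
  by rewrite [pt a c]pt_sym [pt b c]pt_sym eigen_meet //; distinct.
by rewrite eigen_disjoint //; distinct.
Qed.

(** The norm of [pt b c] is computed in the frame: two terms are 9 and the nine others are 64 or 196
    = 64 + 132, so 33 * 30 = 18 + 576 + 132 n and n = 3. *)
Lemma sum_split a b c : uniq [:: a; b; c] ->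
  (\sum_(d | (d != a) && (d != b) && (d != c)) split_rel a d b c)%N = 3%N.
Proof.
move=> u; have := star_eigen a (pt b c) (pt b c); rewrite eigen_diag.
have [ab ac bc] : [/\ b != a, c != a & c != b].
  by move: u; rewrite /= !inE negb_or -andbA ![_ == c]eq_sym [a == b]eq_sym => /and4P[].
rewrite (bigD1 b) //= (bigD1 c) ?ac //= !eigen_star // !inE !eqxx ?orbT /=.
rewrite (eq_bigr (fun d => 64 + 132 * (split_rel a d b c)%:R)) => [|d /andP[/andP[da db] dc]].
  rewrite big_split /= sumr_const -mulr_sumr.
  rewrite (_ : #|_| = 9%N); last first.
    apply: etrans (_ : #|[set d | d \notin [:: a; b; c]]| = _).
      by apply: eq_card => d; rewrite !inE !negb_or andbA.
    by rewrite card_notin // card_ord.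
  rewrite -natr_sum natz -mulr_natr; by set n := (\sum_(_ | _) _)%N; lia.
rewrite eigen_star // !inE (negPf db) (negPf dc) /=.
by case: split_rel.
Qed.

Lemma card_split a b c : uniq [:: a; b; c] ->
  #|[set d | d \notin [:: a; b; c] & split_rel a d b c]| = 3%N.
Proof.
move=> u; apply: etrans (sum_split u).
rewrite -sum1_card [LHS]big_mkcond [RHS]big_mkcond; apply: eq_bigr => d _.
by rewrite !inE !negb_or andbA; case: split_rel; rewrite ?andbT ?andbF //; case: ifP.
Qed.

(** By the previous count the sum is -6 + 9 * 8 - 22 * 3. *)
Lemma sum_eigen_star a b c : uniq [:: a; b; c] ->
  \sum_(d | d != a) eigen (pt b c) (pt a d) = 0.
Proof.
move=> u; have [ab ac bc] : [/\ b != a, c != a & c != b].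
  by move: u; rewrite /= !inE negb_or -andbA ![_ == c]eq_sym [a == b]eq_sym => /and4P[].
rewrite (bigD1 b) //= (bigD1 c) ?ac //= !eigen_star // !inE !eqxx ?orbT /=.
rewrite (eq_bigr (fun d => 8 - 22 * (split_rel a d b c)%:R)) => [|d /andP[/andP[da db] dc]].
  rewrite big_split /= sumr_const sumrN -mulr_sumr.
  rewrite (_ : #|_| = 9%N); last first.
    apply: etrans (_ : #|[set d | d \notin [:: a; b; c]]| = _).
      by apply: eq_card => d; rewrite !inE !negb_or andbA.
    by rewrite card_notin // card_ord.
  by rewrite -natr_sum sum_split.
by rewrite eigen_star // !inE (negPf db) (negPf dc).
Qed.

(** Adding 3 turns the inner products -3, 8, -14 into 0, 11, -11. The sum of products of shifted
    values is 121 times the number of agreements minus the number of differences of the two rows;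
    expanded, it is the left side, as the linear terms vanish and 99 = 11 * 9. *)
Lemma split_distanceE a b c b' c' :
  uniq [:: a; b; c] -> uniq [:: a; b'; c'] ->
  33 * eigen (pt b c) (pt b' c') + 99 =
  121 * (#|[set d | d \notin [:: a; b; c; b'; c']]|%:R -
   2 * (split_distance split_rel a b c b' c')%:R).
Proof.
move=> u u'; transitivity (\sum_(d | d != a)
    (eigen (pt b c) (pt a d) + 3) * (eigen (pt b' c') (pt a d) + 3)).
  transitivity (\sum_(d | d != a) (eigen (pt b c) (pt a d) * eigen (pt b' c') (pt a d)
     + 3 * eigen (pt b c) (pt a d) + 3 * eigen (pt b' c') (pt a d) + 9)).
    rewrite !big_split /= -!mulr_sumr !sum_eigen_star // star_eigen sumr_const.
    rewrite (_ : #|_| = 11%N) ?mulr0 ?addr0 // (eq_card (B := ~: [set a])) => [|d].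
      by rewrite cardsC1 card_ord.
    by rewrite !inE.
  by apply: eq_bigr => d _; ring.
rewrite /split_distance -!sum1_card ![in RHS]natr_sum [\sum_(d in [set _ | _ & _]) _]big_mkcond.
rewrite [\sum_(d in [set _ | _]) _]big_mkcond mulr_sumr -sumrB mulr_sumr big_mkcond /=.
apply: eq_bigr => d _; rewrite !inE; case: (eqVneq d a) => [|da] //=.
rewrite !eigen_star // !inE.
case: (d == b); case: (d == c); case: (d == b'); case: (d == c') => //=;
by case: split_rel; case: split_rel.
Qed.

(** Eight labels remain, and [split_distanceE] becomes 0 = 121 (8 - 2 n). *)
Lemma split_distance_meet a b c d : uniq [:: a; b; c; d] ->
  split_distance split_rel a b c b d = 4%N.
Proof.
move=> u; have [u1 u2 u3] : [/\ uniq [:: a; b; c], uniq [:: a; b; d] & uniq [:: b; c; d]].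
  by move: u; rewrite /= !inE !negb_or -!andbA => /and5P[-> -> -> -> /and3P[-> -> _]].
have := split_distanceE u1 u2; rewrite eigen_meet //.
rewrite (_ : [set e | _] = [set e | e \notin [:: a; b; c; d]]).
  by rewrite card_notin // card_ord /=; set n := split_distance _ _ _ _ _ _; rewrite !natz; lia.
by apply/setP => e; rewrite !inE; do !case: (_ == _).
Qed.

(** Seven labels remain, and 121 (7 - 2 n) is 363 in relation 1 and -363 in relation 3. *)
Lemma split_distance_disjoint a b c d e : uniq [:: a; b; c; d; e] ->
  split_distance split_rel a b c d e = if split_rel b c d e then 5%N else 2%N.
Proof.
move=> u; have [u1 u2 u3] : [/\ uniq [:: a; b; c], uniq [:: a; d; e] & uniq [:: b; c; d; e]].
  by move: u; rewrite /= !inE !negb_or -!andbA => /and5P[-> -> -> -> /and5P[-> -> -> -> /and3P[-> -> _]]].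
have := split_distanceE u1 u2; rewrite eigen_disjoint // card_notin // card_ord /=.
by set n := split_distance _ _ _ _ _ _; rewrite !natz; case: split_rel; lia.
Qed.

End Splits.
End SchemeCount.

(** * Uniqueness of the sign rows *)

Lemma agreementC s t : agreement s t = agreement t s.
Proof. by elim: s t => [|x s IHs] [|y t] //=; rewrite /agreement /= eq_sym -/(agreement s t) IHs. Qed.

Lemma overlapC s t : overlap s t = overlap t s.
Proof. by elim: s t => [|x s IHs] [|y t] //=; rewrite /overlap /= andbC -/(overlap s t) IHs. Qed.

Lemma pairsP s p : reflect [/\ p.1 \in s, p.2 \in s & p.1 < p.2] (p \in pairs s).
Proof.
rewrite mem_filter; apply: (iffP andP) => [[lt_p /allpairsP[[i j] /= [is_ js pE]]]|[i_s j_s lt_p]].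
  by rewrite pE in lt_p *.
by split=> //; apply/allpairsP; exists p; split=> //; apply: surjective_pairing.
Qed.

Lemma pairs_uniq s : uniq s -> uniq (pairs s).
Proof.
move=> us; apply: filter_uniq; apply: allpairs_uniq => // -[i j] [k l] _ _ /=.
by case=> -> ->.
Qed.

Lemma row_of_mark sig p t :
  {in iota 1 11, forall d, d != p.1 -> d != p.2 -> sig 0 d p.1 p.2 = (d \in t)} ->
  row_of sig p = mark p t.
Proof.
move=> sigE; congr (_, _); apply/eq_in_map => d dI; case: eqVneq => //= d1.
by case: eqVneq => //= d2; rewrite sigE.
Qed.

Lemma distance_row_of sig p q : distance (row_of sig p).2 (row_of sig q).2 =
  count (fun d => (d \notin [:: p.1; p.2; q.1; q.2]) &&
                  (sig 0 d p.1 p.2 (+) sig 0 d q.1 q.2)) (iota 1 11).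
Proof.
rewrite /distance /row_of; elim: (iota 1 11) => //= d s ->; congr (_ + _).
by rewrite !inE !negb_or; case: (d == p.1) (d == p.2) (d == q.1) (d == q.2) => [] [] [] [].
Qed.

Lemma mem_nth_map (T : eqType) (x0 : T) (s : seq T) n t : uniq s -> n < size s ->
  {in t, forall j, j < size s} ->
  (nth x0 s n \in [seq nth x0 s j | j <- t]) = (n \in t).
Proof.
move=> us ns ts; apply/mapP/idP => [[j jt /eqP]|nt]; last by exists n.
by rewrite nth_uniq ?(ts j jt) // => /eqP->.
Qed.

Lemma all2_cat (S T : Type) (r : S -> T -> bool) s1 s2 t1 t2 : size s1 = size t1 ->
  all2 r (s1 ++ s2) (t1 ++ t2) = all2 r s1 t1 && all2 r s2 t2.
Proof. by elim: s1 t1 => [|x s1 IHs] [|y t1] //= [/IHs->]; rewrite andbA. Qed.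

Section Labelling.
Variables (sig : 'I_12 -> 'I_12 -> 'I_12 -> 'I_12 -> bool).
Hypothesis sig_swap : forall i j k l, sig i j k l = sig k l i j.
Hypothesis sig_sym : forall i j k l, sig i j k l = sig j i k l.
Hypothesis sig_card : forall a b c, uniq [:: a; b; c] ->
  #|[set d | d \notin [:: a; b; c] & sig a d b c]| = 3.
Hypothesis sig_meet : forall a b c d, uniq [:: a; b; c; d] ->
  split_distance sig a b c b d = 4.
Hypothesis sig_disjoint : forall a b c d e, uniq [:: a; b; c; d; e] ->
  split_distance sig a b c d e = if sig b c d e then 5 else 2.

(** For fixed a and b, joining c to the members of [nb a b c] gives a cubic graph on the ten other
    labels. By the next two lemmas it is undirected without triangles or 4-cycles, hence the
    Petersen graph. *)
Let nb a b c := [set d | d \notin [:: a; b; c] & sig a d b c].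

(* The two sets, without c and d, have 2 and at most 3 elements, and their
   symmetric difference has 4. *)
Lemma nb_sym a b c d : uniq [:: a; b; c] -> d \in nb a b c ->
  c \in nb a b d /\ nb a b c :&: nb a b d = set0.
Proof.
move=> u dc; have := dc; rewrite inE => /andP[dabc _].
have u4 : uniq [:: a; b; c; d].
  by rewrite -[_ :: _]/(rcons [:: a; b; c] d) rcons_uniq dabc.
have ud : uniq [:: a; b; d].
  by move: u4; rewrite /= !inE !negb_or -!andbA => /and5P[-> _ -> _ /and3P[-> _ _]].
set A := nb a b c :\ d; set B := nb a b d :\ c.
have cardA : #|A| = 2 by have := cardsD1 d (nb a b c); rewrite dc sig_card // => -[].
have AB : split_distance sig a b c b d = #|(A :|: B) :\: (A :&: B)|.
  apply: eq_card => e; rewrite !inE.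
  by case: (e == a); case: (e == b); case: (e == c); case: (e == d);
     case: (sig a e b c); case: (sig a e b d).
have := sig_meet u4; rewrite AB cardsDS; last first.
  exact: subset_trans (subsetIl _ _) (subsetUl _ _).
have := cardsUI A B; rewrite cardA.
have cardB := cardsD1 c (nb a b d); rewrite sig_card // -/B in cardB.
have := subset_leq_card (subsetIl A B); rewrite cardA.
case: (boolP (c \in nb a b d)) cardB => cd /=; rewrite ?add0n ?add1n => cardB; last first.
  by rewrite -cardB => le2 UI U4; exfalso; move: le2 UI U4; clear; lia.
case: cardB => <- le2 UI U4.
have I0 : #|A :&: B| = 0.
  by move: le2 UI U4; move: #|A :|: B| #|A :&: B| => m n; clear; lia.
split=> //; have /eqP := cards0_eq I0; rewrite -!subset0 => /subsetP AB0.
apply/setP => x; rewrite in_setI in_set0; apply/negP => /andP[xc xd].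
have : x \in A :&: B.
  rewrite in_setI !in_setD1 xc xd !andbT; apply/andP; split.
    by apply: contraTneq xd => ->; rewrite !inE eqxx !orbT.
  by apply: contraTneq xc => ->; rewrite !inE eqxx !orbT.
by move/AB0; rewrite inE.
Qed.

(** As there are no triangles, d and e are not joined, so the distance 4 is 3 + 3 - 2 m with m the
    number of common neighbours. Thus m = 1, and c is one. *)
Lemma nb_far a b c d e : uniq [:: a; b; c] -> d \in nb a b c -> e \in nb a b c ->
  d != e -> nb a b d :&: nb a b e = [set c].
Proof.
move=> u dc ec de.
have [cd cd0] := nb_sym u dc; have [ce ce0] := nb_sym u ec.
have notin x y : x \in nb a b c -> y \in nb a b c -> nb a b c :&: nb a b y = set0 ->
    x \notin nb a b y.
  move=> xc yc cy0; apply/negP => xy; suff : x \in set0 by rewrite inE.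
  by rewrite -cy0 in_setI xc.
have ed := notin e d ec dc cd0; have de' := notin d e dc ec ce0.
have mem x : x \in nb a b c -> x \notin [:: a; b; c] by rewrite inE => /andP[].
have u4 : uniq [:: a; b; d; e].
  move: (mem d dc) (mem e ec) u; rewrite /= !inE !negb_or -!andbA.
  move=> /and3P[da db _] /and3P[ea eb _] /and4P[ab _ _ _].
  by rewrite ab ![_ == d]eq_sym ![_ == e]eq_sym da db ea eb eq_sym de.
have ud : uniq [:: a; b; d].
  by move: u4; rewrite /= !inE !negb_or -!andbA => /and5P[-> -> _ -> _].
have ue : uniq [:: a; b; e].
  by move: u4; rewrite /= !inE !negb_or -!andbA => /and5P[-> _ -> _ /and3P[-> _ _]].
have := sig_meet u4.
have -> : split_distance sig a b d b e = #|(nb a b d :|: nb a b e) :\: (nb a b d :&: nb a b e)|.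
  apply: eq_card => x; rewrite in_setD in_setI in_setU.
  case: (eqVneq x d) => [->|xd].
    by rewrite (negPf de') !inE eqxx !orbT.
  case: (eqVneq x e) => [->|xe].
    by rewrite (negPf ed) !inE eqxx !orbT.
  rewrite !inE (negPf xd) (negPf xe).
  case: (x == a); case: (x == b) => //=.
  by case: (sig a x b d) (sig a x b e) => [] [].
rewrite cardsDS; last exact: subset_trans (subsetIl _ _) (subsetUl _ _).
have := cardsUI (nb a b d) (nb a b e); rewrite !sig_card //.
move=> UI U4; have I1 : #|nb a b d :&: nb a b e| = 1.
  by move: UI U4; move: #|_ :|: _| #|_ :&: _| => m n; clear; lia.
have /cards1P[x E] : #|nb a b d :&: nb a b e| == 1 by rewrite I1.
have : c \in nb a b d :&: nb a b e by rewrite in_setI cd.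
by rewrite E inE => /eqP->.
Qed.
(** The Petersen graph of labels 0 and 1 is numbered outwards from label 2: its neighbours are 3, 4,
    5, and their further neighbours are the disjoint pairs {6, 7}, {8, 9}, {10, 11}. *)
Lemma nb_labelling : exists s : seq 'I_12, [/\ uniq s, size s = 12 &
  forall c t, (c, t) \in fixed_rows -> forall d, d < 12 -> d \notin [:: 0; 1; c] ->
    sig (nth ord0 s 0) (nth ord0 s d) (nth ord0 s 1) (nth ord0 s c) = (d \in t)].
Proof.
pose a : 'I_12 := ord0; pose b : 'I_12 := inord 1; pose c : 'I_12 := inord 2.
have ab : a != b by rewrite -val_eqE /= inordK.
have uabc : uniq [:: a; b; c] by rewrite /= !inE -!val_eqE /= !inordK.
pose G := nb a b.
have cardG x : x \notin [:: a; b] -> #|G x| = 3.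
  move=> xab; apply: sig_card; rewrite -[_ :: _]/(rcons [:: a; b] x) rcons_uniq xab /= inE.
  by rewrite ab.
have G_out x y : y \in G x -> y \notin [:: a; b; x] by rewrite inE => /andP[].
have G_out2 x y : y \in G x -> y \notin [:: a; b].
  by move/G_out; apply: contra; rewrite !inE => /orP[] ->; rewrite ?orbT.
have cab : c \notin [:: a; b] by rewrite !inE -!val_eqE /= !inordK.
have /card_gt0P[d dc] : 0 < #|G c| by rewrite cardG.
have /eqP/cards2P[e [f [ef defE]]] : #|G c :\ d| = 2.
  by have := cardsD1 d (G c); rewrite dc cardG // => -[].
have [/setD1P[ed ec] /setD1P[fd fc]] : e \in G c :\ d /\ f \in G c :\ d.
  by rewrite defE set21 set22.
have split2 x : x \in G c -> exists y z, [/\ y != z, G x :\ c = [set y; z] & G x =i [:: c; y; z]].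
  move=> xc; have [cx _] := nb_sym uabc xc.
  have /eqP/cards2P[y [z [yz E]]] : #|G x :\ c| = 2.
    by have := cardsD1 c (G x); rewrite cx cardG ?(G_out2 c) // => -[].
  exists y, z; split=> // w.
  have -> : G x = c |: [set y; z] by rewrite -E setD1K.
  by rewrite !inE.
have [g1 [g2 [g12 gE Gd]]] := split2 d dc.
have [h1 [h2 [h12 hE Ge]]] := split2 e ec.
have [i1 [i2 [i12 iE Gf]]] := split2 f fc.
have Gc : G c =i [:: d; e; f].
  move=> x; have -> : G c = d |: [set e; f] by rewrite -defE setD1K.
  by rewrite !inE.
have disj x y z : x \in G c -> y \in G c -> x != y -> z \in G x :\ c -> z \notin G y :\ c.
  move=> xc yc xy /setD1P[zc zx]; apply/negP => /setD1P[_ zy].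
  have : z \in G x :&: G y by rewrite in_setI zx.
  by rewrite /G (nb_far uabc xc yc xy) inE (negPf zc).
have disjc x z : x \in G c -> z \in G x -> z \notin G c.
  move=> xc zx; apply/negP => zc; have [_ /setP/(_ z)] := nb_sym uabc xc.
  by rewrite in_setI in_set0 zc zx.
pose s := [:: a; b; c; d; e; f; g1; g2; h1; h2; i1; i2].
have us : uniq s.
  have out x : x \in G c -> forall y, y \in G x :\ c -> y \notin [:: a; b; c].
    move=> xc y /setD1P[yc yx]; have := G_out2 _ _ yx.
    by rewrite !inE !negb_or yc => /andP[-> ->].
  have inSet y z w : y \in [:: z; w] -> y \in [set z; w] by rewrite !inE.
  have u4 : uniq ([:: h1; h2] ++ [:: i1; i2]).
    rewrite cat_uniq; apply/and3P; split; rewrite ?[uniq _]/= ?inE ?h12 ?i12 //.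
    apply/hasPn => y /inSet; rewrite -iE => yi.
    rewrite (_ : (y \in [:: h1; h2]) = (y \in G e :\ c)); last by rewrite hE !inE.
    by apply: disj yi; rewrite // eq_sym.
  have u3 : uniq ([:: g1; g2] ++ ([:: h1; h2] ++ [:: i1; i2])).
    rewrite cat_uniq u4 andbT; apply/andP; split; first by rewrite /= inE g12.
    apply/hasPn => y; rewrite mem_cat (_ : (y \in [:: g1; g2]) = (y \in G d :\ c)); last by rewrite gE !inE.
    by case/orP => /inSet; rewrite -?hE -?iE; apply: disj; rewrite // eq_sym.
  have u2 : uniq ([:: d; e; f] ++ ([:: g1; g2] ++ ([:: h1; h2] ++ [:: i1; i2]))).
    rewrite cat_uniq u3 andbT; apply/andP; split.
      by rewrite /= !inE negb_or eq_sym ed eq_sym fd ef.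
    apply/hasPn => y; rewrite -Gc.
    rewrite 2!mem_cat => /orP[|/orP[]] /inSet; rewrite -?gE -?hE -?iE => /setD1P[_];
    exact: disjc.
  rewrite -[s]/([:: a; b; c] ++ ([:: d; e; f] ++ ([:: g1; g2] ++ ([:: h1; h2] ++ [:: i1; i2])))).
  rewrite cat_uniq uabc u2 andbT; apply/hasPn => y.
  rewrite 3!mem_cat => /orP[|/orP[|/orP[]]].
  - by rewrite -Gc => /G_out.
  - by move/inSet; rewrite -gE; apply: out.
  - by move/inSet; rewrite -hE; apply: out.
  - by move/inSet; rewrite -iE; apply: out.
exists s; split=> // k t kt n n12 nk.
have ok : k < 12 -> {in t, forall j, j < 12} ->
    G (nth ord0 s k) =i [seq nth ord0 s j | j <- t] ->
    sig (nth ord0 s 0) (nth ord0 s n) (nth ord0 s 1) (nth ord0 s k) = (n \in t).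
  move=> k12 t12 Gk; rewrite -(mem_nth_map ord0 us n12 t12) -Gk inE.
  rewrite -[[:: a; b; _]]/[seq nth ord0 s j | j <- [:: 0; 1; k]].
  rewrite mem_nth_map ?nk //.
  by move=> j; rewrite !inE => /or3P[] /eqP->.
move: kt ok; rewrite !inE => /or4P[] /eqP[-> ->]; apply=> // j;
by rewrite !inE => /or3P[] /eqP->.
Qed.

Lemma sig_symr i j k l : sig i j k l = sig i j l k.
Proof. by rewrite sig_swap sig_sym sig_swap. Qed.

Lemma split_distance_sym a b c b' c' :
  split_distance sig a b c b' c' = split_distance sig a c b b' c'.
Proof. by apply: eq_card => d; rewrite !inE [sig a d b c]sig_symr; do !case: (_ == _). Qed.

Lemma split_distanceC a b c b' c' :
  split_distance sig a b c b' c' = split_distance sig a b' c' b c.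
Proof. by apply: eq_card => d; rewrite !inE addbC; do !case: (_ == _). Qed.

(** * Sign rows of a numbering by 0, ..., 11 *)

Section Numbering.
Variable s : seq 'I_12.
Hypotheses (s_uniq : uniq s) (s_size : size s = 12).
Let u (n : nat) : 'I_12 := nth ord0 s n.
Let tau (i j k l : nat) : bool := sig (u i) (u j) (u k) (u l).

Lemma mem_numbering x : x \in s.
Proof.
have : [set y in s] = setT.
  by apply/eqP; rewrite eqEcard subsetT cardsT card_ord cardsE (card_uniqP s_uniq) s_size.
by move/setP/(_ x); rewrite !inE.
Qed.

Lemma card_numbering (P : pred 'I_12) : #|[set x | P x]| = count (P \o u) (iota 0 12).
Proof.
have us : [seq u i | i <- iota 0 12] = s by have := mkseq_nth ord0 s; rewrite /mkseq s_size.
rewrite -count_map us.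
rewrite cardsE -size_filter -(card_uniqP (filter_uniq P s_uniq)).
by apply: eq_card => x; rewrite mem_filter mem_numbering andbT.
Qed.

Lemma mem_numbers n t : n < 12 -> all (gtn 12) t -> (u n \in map u t) = (n \in t).
Proof. by move=> n12 /allP t12; apply: mem_nth_map; rewrite ?s_size. Qed.

Lemma uniq_numbers t : all (gtn 12) t -> uniq (map u t) = uniq t.
Proof.
move=> /allP t12; apply: map_inj_in_uniq => i j /t12 /= i12 /t12 /= j12 /eqP.
by rewrite nth_uniq ?s_size // => /eqP.
Qed.

Lemma pairs_numbers p : p \in pairs (iota 1 11) ->
  [/\ 0 < p.1, p.1 < 12, 0 < p.2, p.2 < 12 & p.1 < p.2].
Proof. by case/pairsP; rewrite !mem_iota => /andP[-> ?] /andP[-> ?] ->. Qed.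

Lemma row_of_domain p : p \in pairs (iota 1 11) -> row_of tau p \in row_domain p.
Proof.
move=> /pairs_numbers[p1 p1' p2 p2' lt_p].
pose t := [seq d <- iota 1 11 | (d \notin [:: p.1; p.2]) && tau 0 d p.1 p.2].
have tE d : d \in iota 1 11 -> (d \in t) = (d \notin [:: p.1; p.2]) && tau 0 d p.1 p.2.
  by move=> dI; rewrite mem_filter dI andbT.
rewrite (@row_of_mark tau p t) => [|d dI dp1 dp2]; last by rewrite tE // !inE negb_or dp1 dp2.
have p_t : (p.1 \notin t) && (p.2 \notin t).
  by rewrite !mem_filter !inE !eqxx !orbT.
apply: map_f; rewrite mem_filter p_t andTb; apply: mem_increasing_seqs.
- by apply: (subseq_sorted ltn_trans (filter_subseq _ _)); apply: iota_ltn_sorted.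
- have uu : uniq (map u [:: 0; p.1; p.2]).
    by rewrite uniq_numbers /= ?p1' ?p2' // !inE !negb_or ![0 == _]eq_sym -!lt0n p1 p2 ltn_eqF.
  rewrite -(sig_card uu) card_numbering size_filter -[iota 0 12]/(0 :: iota 1 11).
  rewrite [in RHS]/count -/count [X in _ = X + _](_ : _ = 0) ?add0n; last first.
    by rewrite /= inE eqxx.
  apply: eq_in_count => d; rewrite mem_iota => /andP[d0 d12] /=.
  rewrite -[[:: u 0; _; _]]/(map u [:: 0; p.1; p.2]) mem_numbers //=.
    by rewrite [in RHS]inE gtn_eqF.
  by rewrite p1' p2'.
- by apply/allP => d; rewrite mem_filter mem_iota => /andP[_].
Qed.

Lemma distance_numbers p q : p \in pairs (iota 1 11) -> q \in pairs (iota 1 11) ->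
  distance (row_of tau p).2 (row_of tau q).2 =
  split_distance sig (u 0) (u p.1) (u p.2) (u q.1) (u q.2).
Proof.
move=> /pairs_numbers[p1 p1' p2 p2' lt_p] /pairs_numbers[q1 q1' q2 q2' lt_q].
rewrite distance_row_of /split_distance card_numbering.
rewrite -[iota 0 12]/(0 :: iota 1 11) [in RHS]/count -/count [X in _ = X + _](_ : _ = 0) ?add0n; last first.
  by rewrite /= inE eqxx.
apply: eq_in_count => d; rewrite mem_iota => /andP[d0 d12] /=.
rewrite -[[:: u 0; _; _; _; _]]/(map u [:: 0; p.1; p.2; q.1; q.2]) mem_numbers //=.
  by rewrite [in RHS]inE gtn_eqF.
by rewrite p1' p2' q1' q2'.
Qed.

(** Swaps inside the pairs and exchanges of the pairs bring the shared label to the front of both,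
    as [sig_meet] requires. *)
Lemma pairs_cases p q : p \in pairs (iota 1 11) -> q \in pairs (iota 1 11) -> p != q ->
  if meet p q then split_distance sig (u 0) (u p.1) (u p.2) (u q.1) (u q.2) = 4
  else split_distance sig (u 0) (u p.1) (u p.2) (u q.1) (u q.2) =
       if tau p.1 p.2 q.1 q.2 then 5 else 2.
Proof.
case: p q => [i j] [k l] /pairs_numbers/= [i0 i12 j0 j12 ij] /pairs_numbers/= [k0 k12 l0 l12 kl] neq.
have un t : all (gtn 12) t -> uniq t -> uniq (map u t) by move=> t12; rewrite uniq_numbers.
rewrite /meet /=; case: ifP => [|nm]; last first.
  apply: sig_disjoint; apply: (un [:: 0; i; j; k; l]); rewrite /= ?i12 ?j12 ?k12 ?l12 // !inE.
  by move: nm; lia.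
case/or4P => /eqP E; subst.
- apply: sig_meet; apply: (un [:: 0; k; j; l]); rewrite /= ?j12 ?k12 ?l12 // !inE.
  by move: neq; rewrite xpair_eqE; lia.
- rewrite split_distanceC split_distance_sym split_distanceC.
  apply: sig_meet; apply: (un [:: 0; l; j; k]); rewrite /= ?j12 ?k12 ?l12 // !inE.
  by move: neq; rewrite xpair_eqE; lia.
- rewrite split_distance_sym.
  apply: sig_meet; apply: (un [:: 0; k; i; l]); rewrite /= ?i12 ?k12 ?l12 // !inE.
  by move: neq; rewrite xpair_eqE; lia.
- rewrite split_distance_sym split_distanceC split_distance_sym split_distanceC.
  apply: sig_meet; apply: (un [:: 0; l; i; k]); rewrite /= ?i12 ?k12 ?l12 // !inE.
  by move: neq; rewrite xpair_eqE; lia.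
Qed.

Lemma row_of_compat p q : p \in pairs (iota 1 11) -> q \in pairs (iota 1 11) -> p != q ->
  row_compat (row_of tau p) (row_of tau q).
Proof.
move=> pI qI neq; have := pairs_cases pI qI neq.
rewrite /row_compat distance_numbers // [(row_of tau p).1]/= [(row_of tau q).1]/=.
by case: (meet p q) => ->; rewrite ?eqxx //; case: (tau _ _ _ _).
Qed.

End Numbering.
(** The search settles the signs involving a pair through 0. Those between other disjoint pairs
    follow from distances of rows, and the symmetries of [sig] and [model_rel] cover all orders of
    the four labels. *)
Lemma splits_model : exists lab : 'I_12 -> nat,
  [/\ injective lab, forall i, lab i < 12 &
      forall i j k l, uniq [:: i; j; k; l] ->
        sig i j k l = model_rel (lab i) (lab j) (lab k) (lab l)].
Proof.
have [s [us ss marks]] := nb_labelling.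
pose u n := nth ord0 s n; pose tau i j k l := sig (u i) (u j) (u k) (u l).
pose I := pairs (iota 1 11).
have fixed c t : (c, t) \in fixed_rows -> row_of tau (1, c) = mark (1, c) t.
  move=> ct; apply: row_of_mark => d; rewrite mem_iota => /andP[d0 d12] d1 dc.
  by apply: marks; rewrite // !inE gtn_eqF //= negb_or d1.
have sol_mem : all2 (fun a d => a \in d) (map (row_of tau) I) row_doms.
  rewrite -(cat_take_drop 4 I) map_cat /row_doms.
  have all2_map (K : seq (nat * nat)) : {subset K <= I} ->
      all2 (fun a d => a \in d) (map (row_of tau) K) (map row_domain K).
    elim: K => //= p K IHK sub; rewrite row_of_domain //; last by apply: sub; rewrite mem_head.
    by apply: IHK => q qK; apply: sub; rewrite inE qK orbT.
  rewrite all2_cat //; apply/andP; split; last by apply: all2_map => p; apply: mem_drop.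
  rewrite [take 4 I]/= /fixed_rows /= (fixed 2 [:: 3; 4; 5]) // (fixed 3 [:: 2; 6; 7]) //.
  by rewrite (fixed 4 [:: 2; 8; 9]) // (fixed 5 [:: 2; 10; 11]) // !inE !eqxx.
have sol_pw : pairwise row_compat (map (row_of tau) I).
  rewrite pairwise_map; apply: (@sub_in_pairwise _ (mem I) (fun p q => p != q)).
  - by move=> p q pI qI; apply: row_of_compat.
  - exact/allP.
  - by rewrite -uniq_pairwise; apply: pairs_uniq; apply: iota_uniq.
have := searchP row_search sol_mem sol_pw.
case/hasP => r r_rel /eqP /(can_inj (@revK _)) /eq_in_map rowE.
have rowE' p d : p \in I -> 0 < d < 12 -> d != p.1 -> d != p.2 ->
    tau 0 d p.1 p.2 = relabel r model_rel 0 d p.1 p.2.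
  move=> pI d12 d1 d2; have /eq_in_map/(_ d) := congr1 snd (rowE p pI).
  by rewrite mem_iota (negPf d1) (negPf d2) => /(_ d12) [].
(* Equal rows have equal distances, and the distance, 5 or 2, determines the sign on both sides. *)
have disjE p q : p \in I -> q \in I -> ~~ meet p q ->
    tau p.1 p.2 q.1 q.2 = relabel r model_rel p.1 p.2 q.1 q.2.
  move=> pI qI npq.
  have neq : p != q by apply: contraNneq npq => ->; rewrite /meet eqxx.
  have := pairs_cases us ss pI qI neq; rewrite (negPf npq).
  rewrite -(distance_numbers us ss pI qI) -/u -/tau rowE // rowE // => D.
  have /allP/(_ r r_rel)/allP/(_ _ (map_f _ pI))/allP/(_ _ (map_f _ qI)) := model_rows_distance.
  rewrite (negPf npq) /= D => /eqP <-; rewrite /tau /u; by case: (sig _ _ _ _).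
have model_relC i j k l : model_rel i j k l = model_rel k l i j.
  by rewrite /model_rel overlapC.
have model_relS i j k l : model_rel i j k l = model_rel j i k l.
  by rewrite /model_rel [model_block i j]agreementC.
pose good i j k l := tau i j k l = relabel r model_rel i j k l.
have goodS i j k l : good i j k l -> good j i k l.
  by rewrite /good /tau /relabel sig_sym model_relS.
have goodC i j k l : good i j k l -> good k l i j.
  by rewrite /good /tau /relabel sig_swap model_relC.
have goodR i j k l : good i j k l -> good i j l k by move/goodC/goodS/goodC.
have inI i j : 0 < i -> i < j -> j < 12 -> (i, j) \in I.
  move=> i0 ij j12; apply/pairsP; rewrite !mem_iota.
  by rewrite /= i0 j12 (ltn_trans i0 ij) (ltn_trans ij j12).
have good_pos i j k l : 0 < i < 12 -> 0 < j < 12 -> 0 < k < 12 -> 0 < l < 12 ->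
    uniq [:: i; j; k; l] -> good i j k l.
  have ordered a b c d : 0 < a -> a < b -> b < 12 -> 0 < c -> c < d -> d < 12 ->
      uniq [:: a; b; c; d] -> good a b c d.
    move=> a0 ab b12 c0 cd d12; rewrite /= !inE !negb_or -!andbA.
    case/and5P=> _ ac ad bc /and3P[bd _ _].
    apply: (disjE (a, b) (c, d)); rewrite ?inI //.
    by rewrite /meet /= (negPf ac) (negPf ad) (negPf bc) (negPf bd).
  have half a b c d : 0 < a -> a < b -> b < 12 -> 0 < c < 12 -> 0 < d < 12 ->
      uniq [:: a; b; c; d] -> good a b c d.
    move=> a0 ab b12 /andP[c0 c12] /andP[d0 d12] un; case: (ltngtP c d) => cd.
    - exact: ordered.
    - apply/goodR/ordered => //; rewrite -(perm_uniq (s1 := [:: a; b; c; d])) //.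
      by rewrite !perm_cons (perm_catC [:: c] [:: d]).
    - by move: un; rewrite cd /= !inE eqxx !andbF.
  move=> /andP[i0 i12] /andP[j0 j12] k012 l012 un; case: (ltngtP i j) => ij.
  - exact: half.
  - apply/goodS/half => //; rewrite -(perm_uniq (s1 := [:: i; j; k; l])) //.
    by rewrite (perm_catCA [:: i] [:: j] [:: k; l]).
  - by move: un; rewrite ij /= !inE eqxx.
have good0 d k l : d < 12 -> k < 12 -> l < 12 -> uniq [:: 0; d; k; l] -> good 0 d k l.
  have ordered b c e : b < 12 -> c < e -> e < 12 -> uniq [:: 0; b; c; e] -> good 0 b c e.
    move=> b12 ce e12; rewrite /= !inE !negb_or -!andbA ![0 == _]eq_sym -!lt0n.
    case/and5P=> b0 c0 e0 bc /and3P[be _ _].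
    by apply: (rowE' (c, e)); rewrite ?inI ?b0.
  move=> d12 k12 l12 un; case: (ltngtP k l) => kl.
  - exact: ordered.
  - apply/goodR/ordered => //; rewrite -(perm_uniq (s1 := [:: 0; d; k; l])) //.
    by rewrite !perm_cons (perm_catC [:: k] [:: l]).
  - by move: un; rewrite kl /= !inE eqxx !andbF.
have good_all i j k l : i < 12 -> j < 12 -> k < 12 -> l < 12 ->
    uniq [:: i; j; k; l] -> good i j k l.
  move=> i12 j12 k12 l12 un.
  case: (posnP i) => [i0|i0]; first by subst; apply: good0.
  case: (posnP j) => [j0|j0].
    subst; apply/goodS/good0 => //; rewrite -(perm_uniq (s1 := [:: i; 0; k; l])) //.
    by rewrite (perm_catCA [:: i] [:: 0] [:: k; l]).
  case: (posnP k) => [k0|k0].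
    subst; apply/goodC/good0 => //; rewrite -(perm_uniq (s1 := [:: i; j; 0; l])) //.
    by rewrite (perm_catC [:: i; j] [:: 0; l]).
  case: (posnP l) => [l0|l0].
    subst; apply/goodC/goodS/good0 => //; rewrite -(perm_uniq (s1 := [:: i; j; k; 0])) //.
    by rewrite (perm_catC [:: i; j; k] [:: 0]) /= perm_cons (perm_catC [:: i; j] [:: k]).
  by apply: good_pos; rewrite ?i0 ?j0 ?k0 ?l0.
have r_perm : perm_eq r (iota 0 12).
  have : all (fun r => perm_eq r (iota 0 12)) relabellings by vm_compute.
  by move/allP; apply.
have size_r : size r = 12 by rewrite (perm_size r_perm).
have r_uniq : uniq r by rewrite (perm_uniq r_perm) iota_uniq.
have idx12 x : index x s < 12 by rewrite -[X in _ < X]ss index_mem mem_numbering.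
have u_index x : u (index x s) = x by rewrite /u nth_index // mem_numbering.
have idx_inj : injective (index^~ s) by move=> x y /(congr1 u); rewrite !u_index.
exists (fun x => nth 0 r (index x s)); split.
- move=> x y /eqP; rewrite nth_uniq ?size_r // => /eqP; exact: idx_inj.
- move=> x; have : nth 0 r (index x s) \in r by rewrite mem_nth ?size_r.
  by rewrite (perm_mem r_perm) mem_iota.
move=> i j k l un; rewrite -{1}[i]u_index -{1}[j]u_index -{1}[k]u_index -{1}[l]u_index.
apply: good_all => //; rewrite -(map_inj_uniq idx_inj) in un.
exact: un.
Qed.
End Labelling.

(** * Uniqueness of the Witt design *)

Section Witt.
Variables (P : finType) (W : {set {set P}}).
Hypothesis hW : is_design 4 11 5 1 W.

Let cardP : #|P| = 11. Proof. by case: hW. Qed.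

Lemma witt_block_card B : B \in W -> #|B| = 5.
Proof. by case: hW => _ + _; apply. Qed.

Lemma witt_block_eq (t : seq P) B B' : uniq t -> size t = 4 -> B \in W -> B' \in W ->
  {subset t <= B} -> {subset t <= B'} -> B = B'.
Proof.
move=> ut st BW B'W tB tB'; have [_ _ h] := hW.
have ct : #|[set x in t]| = 4 by rewrite cardsE (card_uniqP ut).
have /eqP/cards1P[C CE] := h _ ct.
have memC D : D \in W -> {subset t <= D} -> D = C.
  move=> DW tD; apply/set1P; rewrite -CE inE DW; apply/subsetP => x.
  by rewrite inE; apply: tD.
by rewrite (memC B) // (memC B').
Qed.

Lemma witt_fifth (t : seq P) : uniq t -> size t = 4 ->
  exists2 x, x \notin t & [set y in x :: t] \in W.
Proof.
move=> ut st; have [_ h5 h] := hW.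
have ct : #|[set x in t]| = 4 by rewrite cardsE (card_uniqP ut).
have /eqP/cards1P[C CE] := h _ ct.
have : C \in [set B in W | [set x in t] \subset B] by rewrite CE set11.
rewrite inE => /andP[CW tC]; have : #|C :\: [set x in t]| == 1.
  by rewrite cardsDS // h5 // ct.
case/cards1P => x xE; have : x \in C :\: [set x in t] by rewrite xE set11.
rewrite !inE => /andP[xt xC]; exists x => //.
suff -> : [set y in x :: t] = C by [].
rewrite -(setID C [set x in t]) xE (setIidPr tC); apply/setP => y.
by rewrite !inE orbC.
Qed.

Section Numbered.
Variable x0 : P.

Definition numbered (s : seq P) (t : seq nat) : {set P} :=
  [set y in [seq nth x0 s i | i <- t]].

(** The normal form is built point by point: n points are numbered so far, and [bs] lists the blocks
    already known in terms of these numbers. *)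
Definition partial_labelling (n : nat) (bs : seq (seq nat)) : Prop :=
  exists s : seq P, [/\ uniq s, size s = n &
    {in bs, forall t, all (gtn n) t /\ numbered s t \in W}].

Lemma numbered_rcons s x t : all (gtn (size s)) t -> numbered (rcons s x) t = numbered s t.
Proof.
move=> /allP ts; rewrite /numbered.
have -> // : [seq nth x0 (rcons s x) i | i <- t] = [seq nth x0 s i | i <- t].
by apply/eq_in_map => i /ts /= lt_i; rewrite nth_rcons lt_i.
Qed.

Lemma partial_labelling_free n bs : n < 11 -> partial_labelling n bs ->
  partial_labelling n.+1 bs.
Proof.
move=> n11 [s [us ss sbs]].
have [x xs] : exists x, x \notin s.
  case: (pickP [pred x | x \notin s]) => [x xs|all_s]; first by exists x.
  suff : 11 <= size s by rewrite ss leqNgt n11.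
  rewrite -cardP; apply: leq_trans (card_size s); apply/subset_leq_card/subsetP => x _.
  by have /negbFE := all_s x.
exists (rcons s x); split; rewrite ?rcons_uniq ?xs ?size_rcons ?ss //.
move=> t /sbs[tn tW]; split; last by rewrite numbered_rcons ?ss.
by apply: sub_all tn => i /= /ltnW.
Qed.

(* The last point of the block on t is new: an old point i of a block u with
   three points in t would force t to lie in u. *)
Lemma partial_labelling_block n bs t : partial_labelling n bs ->
  uniq t -> size t = 4 -> all (gtn n) t ->
  all (fun i => (i \in t) || has (fun u => [&& i \in u, 3 <= count (mem u) t & ~~ all (mem u) t]) bs)
    (iota 0 n) ->
  partial_labelling n.+1 (rcons t n :: bs).
Proof.
move=> [s [us ss sbs]] ut st tn fresh.
have nth_inj : {in gtn n &, injective (nth x0 s)}.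
  by move=> i j; rewrite !inE => i_n j_n /eqP; rewrite nth_uniq ?ss // => /eqP.
have uniq_num u : all (gtn n) u -> uniq [seq nth x0 s i | i <- u] = uniq u.
  by move=> /allP un; apply: map_inj_in_uniq => i j /un iu /un ju; apply: nth_inj.
have mem_num u i : all (gtn n) u -> i < n -> (nth x0 s i \in numbered s u) = (i \in u).
  by move=> /allP un lt_i; rewrite inE mem_nth_map ?ss.
have [x xt xW] : exists2 x, x \notin [seq nth x0 s i | i <- t] &
    [set y in x :: [seq nth x0 s i | i <- t]] \in W.
  by apply: witt_fifth; rewrite ?uniq_num ?size_map.
set B := [set y in _] in xW.
have tB i : i \in t -> nth x0 s i \in B.
  by move=> it; rewrite !inE map_f ?orbT.
have xs : x \notin s.
  apply/negP => /(nthP x0)[i]; rewrite ss => i_n xE.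
  have iI : i \in iota 0 n by rewrite mem_iota.
  case/orP: (allP fresh i iI) => [it|/hasP[u ubs /and3P[iu cu /allPn[j jt ju]]]].
    by case/negP: xt; rewrite -xE map_f.
  have [un uW] := sbs u ubs; case/negP: ju.
  have j_n : j < n := allP tn j jt.
  rewrite /= -(mem_num u j un j_n).
  pose v := i :: take 3 [seq k <- t | k \in u].
  have v_u : {subset v <= u}.
    by move=> k; rewrite inE => /orP[/eqP->//|/mem_take]; rewrite mem_filter => /andP[].
  have v_t k : k \in take 3 [seq k <- t | k \in u] -> k \in t.
    by move/mem_take; rewrite mem_filter => /andP[].
  have vn : all (gtn n) v by apply/allP => k /v_u ku; apply: (allP un).
  rewrite -(_ : B = numbered s u) ?tB //.
  apply: (@witt_block_eq [seq nth x0 s k | k <- v]) => //.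
  - rewrite uniq_num //= take_uniq ?filter_uniq // andbT.
    by apply: contra xt => /v_t it; rewrite -xE map_f.
  - by rewrite size_map /= size_takel // size_filter.
  - move=> y; rewrite /= inE => /orP[/eqP->|/mapP[k /v_t kt ->]]; last exact: tB.
    by rewrite xE !inE eqxx.
  - by move=> y /mapP[k /v_u ku ->]; rewrite inE map_f.
exists (rcons s x); split; rewrite ?rcons_uniq ?xs ?size_rcons ?ss // => u.
rewrite inE => /orP[/eqP->|/sbs[un uW]]; last first.
  by rewrite numbered_rcons ?ss //; split=> //; apply: sub_all un => i /= /ltnW.
split.
  by rewrite all_rcons /= ltnSn; apply: sub_all tn => i /= /ltnW.
suff -> : numbered (rcons s x) (rcons t n) = B by [].
apply/setP => y; rewrite /numbered map_rcons !inE mem_rcons inE nth_rcons ss ltnn eqxx.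
have -> // : [seq nth x0 (rcons s x) i | i <- t] = [seq nth x0 s i | i <- t].
by apply/eq_in_map => i /(allP tn) /= lt_i; rewrite nth_rcons ss lt_i.
Qed.

(** Read from the last line upwards: 0, 1, 2, 3, then 5 and 9, are free choices of new points, while
    4, 6, 7, 8 and 10 each complete a block on four points already numbered. *)
Lemma witt_labelling : partial_labelling 11 first_blocks.
Proof.
apply: (@partial_labelling_block 10 _ [:: 0; 1; 2; 9]) => //.
apply: partial_labelling_free => //.
apply: (@partial_labelling_block 8 _ [:: 0; 1; 2; 7]) => //.
apply: (@partial_labelling_block 7 _ [:: 0; 1; 3; 5]) => //.
apply: (@partial_labelling_block 6 _ [:: 0; 1; 2; 5]) => //.
apply: partial_labelling_free => //.
apply: (@partial_labelling_block 4 _ [:: 0; 1; 2; 3]) => //.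
do 4!apply: partial_labelling_free => //.
by exists [::].
Qed.

Definition incidence (s : seq P) (B : {set P}) : bitseq := [seq x \in B | x <- s].

Lemma overlap_incidence s B B' : uniq s -> size s = 11 ->
  overlap (incidence s B) (incidence s B') = #|B :&: B'|.
Proof.
move=> us ss.
have allP x : x \in s.
  have : [set y in s] = setT.
    by apply/eqP; rewrite eqEcard subsetT cardsT cardP cardsE (card_uniqP us) ss.
  by move/setP/(_ x); rewrite !inE.
transitivity (count (mem (B :&: B')) s).
  by elim: (s) => //= x t IHt; rewrite /overlap /= -/(overlap _ _) IHt inE.
rewrite -size_filter -(card_uniqP (filter_uniq _ us)).
by apply: eq_card => x; rewrite mem_filter allP andbT.
Qed.

Lemma card_block_meet B B' : B \in W -> B' \in W -> B != B' -> #|B :&: B'| <= 3.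
Proof.
move=> BW B'W; apply: contraNT; rewrite -ltnNge => lt3.
apply/eqP/(@witt_block_eq (take 4 (enum (B :&: B')))) => //.
- by rewrite take_uniq ?enum_uniq.
- by rewrite size_takel // -cardE.
- by move=> x /mem_take; rewrite mem_enum => /setIP[].
- by move=> x /mem_take; rewrite mem_enum => /setIP[].
Qed.

(** The prescribed blocks and the blocks through all quadruples of 0, ..., 9 solve the search
    problem, so together they form a relabelled model. They are all the blocks of W. *)
Theorem witt_unique : exists pos : P -> nat,
  [/\ injective pos, forall x, pos x < 11 &
      forall B, (B \in W) = (B \in [seq [set x | nth false b (pos x)] | b <- model_blocks])].
Proof.
have [s [us ss first_W]] := witt_labelling.
have mem_s x : x \in s.
  have : [set y in s] = setT.
    by apply/eqP; rewrite eqEcard subsetT cardsT cardP cardsE (card_uniqP us) ss.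
  by move/setP/(_ x); rewrite !inE.
have sE : [seq nth x0 s i | i <- iota 0 11] = s.
  by have := mkseq_nth x0 s; rewrite /mkseq ss.
pose Q := [seq incidence s B | B <- enum W].
have incQ B : B \in W -> incidence s B \in Q by move=> BW; rewrite map_f ?mem_enum.
have inc_num t : all (gtn 11) t -> incidence s (numbered s t) = bits 11 t.
  move=> /allP t11; have := map_comp (fun x => x \in numbered s t) (nth x0 s) (iota 0 11).
  rewrite sE => E; apply: etrans (esym E) _; apply/eq_in_map => i.
  rewrite mem_iota => /= lt_i; by rewrite inE mem_nth_map ?ss.
pose quads := increasing_seqs 10 0 4.
have quadsP t : t \in quads -> [/\ uniq t, size t = 4 & all (gtn 11) t].
  have : all (fun t => [&& uniq t, size t == 4 & all (gtn 11) t]) quads by vm_compute.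
  by move/allP => h /h /and3P[? /eqP ? ?].
(* The block through the four points numbered by t; [set0] is never reached for a quadruple, by
   [blP]. *)
pose bl t := odflt set0 [pick B in W | all (fun i => nth x0 s i \in B) t].
have blP t : t \in quads -> exists i, [/\ i < 11, i \notin t, bl t \in W & bl t = numbered s (i :: t)].
  move=> /quadsP[ut st t11].
  have ut' : uniq [seq nth x0 s i | i <- t].
    rewrite map_inj_in_uniq // => i j /(allP t11) /= i11 /(allP t11) /= j11 /eqP.
    by rewrite nth_uniq ?ss // => /eqP.
  have [x xt xW] := witt_fifth ut' (etrans (size_map _ _) st).
  have xE : nth x0 s (index x s) = x by rewrite nth_index.
  exists (index x s).
  have numE : [set y in x :: [seq nth x0 s i | i <- t]] = numbered s (index x s :: t).
    by rewrite /numbered /= xE.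
  rewrite /bl; case: pickP => [B /andP[BW /allP tB]|/(_ (numbered s (index x s :: t)))].
    split=> //=; first by rewrite -ss index_mem.
      by apply: contra xt => it; rewrite -xE map_f.
    rewrite -numE; apply: (witt_block_eq ut' (etrans (size_map _ _) st)) => //.
      by move=> y /mapP[i /tB iB ->].
    by move=> y yt; rewrite !inE yt orbT.
  rewrite -numE xW => /allPn[i it]; by rewrite !inE map_f ?orbT.
pose sol := map (bits 11) first_blocks ++ [seq incidence s (bl t) | t <- quads].
have sol_mem : all2 (fun a d => a \in d) sol block_doms.
  rewrite /block_doms all2_cat ?size_map //; apply/andP; split.
    by elim: first_blocks => //= t ts ->; rewrite mem_seq1 eqxx.
  suff all_ts ts : {subset ts <= quads} ->
      all2 (fun a d => a \in d) [seq incidence s (bl t) | t <- ts] (map block_domain ts).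
    exact: all_ts.
  elim: ts => //= t ts IHts sub; rewrite IHts => [|u uts]; last by rewrite sub // inE uts orbT.
  rewrite andbT; have tq : t \in quads by rewrite sub // mem_head.
  have [i [i11 it _ ->]] := blP t tq; have [_ _ t11] := quadsP t tq.
  rewrite inc_num /= ?i11 //; apply: (map_f (fun x => bits 11 (x :: t))).
  by rewrite mem_filter it mem_iota.
have solQ : all (mem Q) sol.
  rewrite all_cat; apply/andP; split; apply/allP => m.
    case/mapP => t /first_W[t11 tW] ->.
    by rewrite -(inc_num t t11); apply: incQ.
  by case/mapP => t /blP[i [_ _ blW _]] ->; apply: incQ.
have sol_pw : pairwise block_compat sol.
  elim: sol solQ {sol_mem} => //= m ms IHms /andP[mQ msQ]; rewrite IHms // andbT.
  apply/allP => m' /(allP msQ) m'Q; move: mQ m'Q => /mapP[B BW ->] /mapP[B' B'W ->].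
  rewrite !mem_enum in BW B'W; rewrite /block_compat overlap_incidence //.
  by case: (eqVneq B B') => [->|neq]; rewrite ?eqxx // card_block_meet ?orbT.
have mem_sol t : t \in quads -> incidence s (bl t) \in sol.
  by move=> tq; rewrite mem_cat (map_f (fun u => incidence s (bl u)) tq) orbT.
clearbody sol; have := searchP block_search sol_mem sol_pw.
rewrite catrevE cats0 /block_leaf => /hasP[r r_rel /andP[/allP sol_model /allP model_sol]].
pose pos x := nth 0 r (index x s).
have [r_uniq size_r r11] : [/\ uniq r, size r = 11 & all (gtn 11) r].
  have : all (fun r => [&& uniq r, size r == 11 & all (gtn 11) r]) point_relabellings by vm_compute.
  by move/allP/(_ r r_rel)/and3P => [? /eqP ? ?].
have idx11 x : index x s < 11 by rewrite -ss index_mem.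
exists pos; split.
- move=> x y /eqP; rewrite nth_uniq ?size_r // => /eqP /(congr1 (nth x0 s)).
  by rewrite !nth_index.
- by move=> x; apply: (allP r11); rewrite mem_nth ?size_r.
have setE B b : incidence s B = [seq nth false b i | i <- r] -> B = [set x | nth false b (pos x)].
  move=> E; apply/setP => x; rewrite inE.
  have := congr1 (fun m => nth false m (index x s)) E.
  by rewrite (nth_map x0) ?index_mem // nth_index // (nth_map 0) ?size_r.
move=> B; apply/idP/mapP => [BW | [b b_model ->]].
  (* The four smallest numbers in a block lie below its fifth, hence among 0, ..., 9. *)
  have [t tq tB] : exists2 t, t \in quads & all (fun i => nth x0 s i \in B) t.
    pose l := [seq i <- iota 0 11 | nth x0 s i \in B].
    have sl : size l = 5.
      apply: etrans (witt_block_card BW).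
      rewrite size_filter -(count_map (nth x0 s) (mem B)).
      rewrite sE -size_filter -(card_uniqP (filter_uniq _ us)).
      by apply: eq_card => x; rewrite mem_filter mem_s andbT.
    have l_sorted : sorted ltn l.
      exact: (subseq_sorted ltn_trans (filter_subseq _ _) (iota_ltn_sorted _ _)).
    have l_in i : i \in l -> (nth x0 s i \in B) && (i < 11).
      by rewrite mem_filter mem_iota.
    move: l l_sorted l_in sl => [|a [|b [|c [|d [|e [|]]]]]] //= lt_l l_in _.
    exists [:: a; b; c; d]; last first.
      apply/allP => i il; have : i \in [:: a; b; c; d; e].
        by move: il; rewrite !inE => /or4P[] ->; rewrite ?orbT.
      by case/l_in/andP.
    have /andP[_ e11] : (nth x0 s e \in B) && (e < 11) by apply: l_in; rewrite !inE eqxx !orbT.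
    case/and5P: lt_l => ab bc cd de _.
    by apply: mem_increasing_seqs; rewrite //= ?ab ?bc ?cd //; lia.
  have [i [i11 it blW blE]] := blP t tq; have [ut st t11] := quadsP t tq.
  have BE : B = bl t.
    apply: (@witt_block_eq [seq nth x0 s i | i <- t]) => //.
    - rewrite map_inj_in_uniq // => j k /(allP t11) /= j11 /(allP t11) /= k11 /eqP.
      by rewrite nth_uniq ?ss // => /eqP.
    - by rewrite size_map.
    - by move=> y /mapP[j /(allP tB) jB ->].
    - by move=> y /mapP[j jt ->]; rewrite blE inE map_f // inE jt orbT.
  have /sol_model/mapP[b b_model bE] : incidence s B \in rev sol.
    by rewrite mem_rev BE mem_sol.
  by exists b => //; apply: setE.
(* Conversely, a relabelled model block occurs in the solution, whose entries are all incidence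
   vectors of blocks of W. *)
have : [seq nth false b i | i <- r] \in rev sol 
  by apply: model_sol; apply: (map_f (fun b => [seq nth false b i | i <- r])).
rewrite mem_rev => /(allP solQ) /mapP[B0 BW /esym/setE <-].
by rewrite mem_enum in BW.
Qed.

End Numbered.
End Witt.

(** * The isomorphism *)

Definition overlap_value (i : nat) : nat := nth 0 [:: 5; 3; 2; 1] i.

Lemma model_overlap :
  all (fun p => all (fun q =>
    let n := overlap (model_block p.1 p.2) (model_block q.1 q.2) in
    if p == q then n == 5 else if meet p q then n == 2 else (n == 1) || (n == 3))
    (pairs (iota 0 12))) (pairs (iota 0 12)).
Proof. by vm_compute. Qed.

Lemma size_model_blocks b : b \in model_blocks -> size b = 11.
Proof.
have : all (fun b => size b == 11) model_blocks by vm_compute.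
by move/allP => h /h /eqP.
Qed.

Lemma card_overlap (P : finType) (pos : P -> nat) (b b' : bitseq) :
  #|P| = 11 -> injective pos -> (forall x, pos x < 11) ->
  size b = 11 -> size b' = 11 ->
  #|[set x | nth false b (pos x)] :&: [set x | nth false b' (pos x)]| = overlap b b'.
Proof.
move=> cardP pos_inj pos11 sb sb'.
have perm_pos : perm_eq (map pos (enum P)) (iota 0 11).
  apply: uniq_perm; rewrite ?iota_uniq ?(map_inj_uniq pos_inj) ?enum_uniq //.
  apply: (uniq_min_size _ _ _).2.
  - by rewrite (map_inj_uniq pos_inj) enum_uniq.
  - by move=> i /mapP[x _ ->]; rewrite mem_iota pos11.
  - by rewrite size_iota size_map -cardE cardP.
have -> : overlap b b' = count (fun i => nth false b i && nth false b' i) (iota 0 11).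
  rewrite /overlap -(mkseq_nth (false, false) (zip b b')) /mkseq count_map size_zip sb sb' minnn.
  by apply: eq_in_count => i; rewrite mem_iota => /= i11; rewrite nth_zip ?sb ?sb'.
rewrite -(permP perm_pos) count_map cardE size_filter enumT.
by apply: eq_count => x; rewrite /= !inE.
Qed.

(** A vertex is a pair of labels and goes to the agreement set of the two corresponding Hadamard
    rows. Overlaps 5 and 2 reflect equal and meeting pairs; for disjoint pairs the overlap is 1 or
    3, and [splits_model] matches 1 with relation 3. *)
Theorem scheme_blocks (X : finType) (S : symmetric_scheme 3 X)
    (hS : forall i j k : 'I_4, inter_num S i j k = witt_inter_num i j k) :
  exists f : X -> bitseq, (forall x, f x \in model_blocks) /\
    forall x y, overlap (f x) (f y) = overlap_value (rel_index S x y).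
Proof.
have [pt [onto sym adj nadj]] := scheme_pairs hS.
pose sig := split_rel S pt.
have [lab [lab_inj lab12 sigE]] : exists lab : 'I_12 -> nat,
  [/\ injective lab, forall i, lab i < 12 &
      forall i j k l, uniq [:: i; j; k; l] ->
        sig i j k l = model_rel (lab i) (lab j) (lab k) (lab l)].
  apply: splits_model.
  - by move=> i j k l; rewrite /sig /split_rel rel_index_sym.
  - by move=> i j k l; rewrite /sig /split_rel sym.
  - by move=> a b c; apply: card_split.
  - by move=> a b c d; apply: split_distance_meet.
  - by move=> a b c d e; apply: split_distance_disjoint.
(* The vertex is named by its two model labels in increasing order, so that equality of vertices
   becomes equality of names. *)
pose named x p := [exists i, exists j, [&& x == pt i j, lab i == p.1 & lab j == p.2]].
have ex_name x : has (named x) (pairs (iota 0 12)).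
  have [i [j [ij xE]]] := onto x; apply/hasP.
  have : lab i != lab j by rewrite (inj_eq lab_inj).
  rewrite neq_ltn => /orP[lt_ij|lt_ji].
    exists (lab i, lab j).
      by apply/pairsP; rewrite !mem_iota /= !lab12.
    by apply/existsP; exists i; apply/existsP; exists j; rewrite xE !eqxx.
  exists (lab j, lab i).
    by apply/pairsP; rewrite !mem_iota /= !lab12.
  by apply/existsP; exists j; apply/existsP; exists i; rewrite xE sym !eqxx.
pose name x := nth (0, 0) (pairs (iota 0 12)) (find (named x) (pairs (iota 0 12))).
have name_in x : name x \in pairs (iota 0 12) by rewrite mem_nth // -has_find.
have nameP x : exists i j, [/\ x = pt i j, lab i = (name x).1 & lab j = (name x).2].
  have /existsP[i /existsP[j /and3P[/eqP xE /eqP iE /eqP jE]]] := nth_find (0, 0) (ex_name x).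
  by exists i, j.
clearbody name; exists (fun x => model_block (name x).1 (name x).2); split=> [x|x y].
  exact: (map_f (fun p => model_block p.1 p.2)).
have /allP/(_ _ (name_in x))/allP/(_ _ (name_in y)) := model_overlap.
have [i [j [xE iE jE]]] := nameP x; have [k [l [yE kE lE]]] := nameP y.
have /pairsP[_ _ ltx] := name_in x; have /pairsP[_ _ lty] := name_in y.
have ij : i != j by rewrite -(inj_eq lab_inj) iE jE ltn_eqF.
have kl : k != l by rewrite -(inj_eq lab_inj) kE lE ltn_eqF.
have -> : meet (name x) (name y) = [|| i == k, i == l, j == k | j == l].
  by rewrite /meet -iE -jE -kE -lE !(inj_eq lab_inj).
have -> : (name x == name y) = (i == k) && (j == l).
  have pair_eq (p q : nat * nat) : (p == q) = (p.1 == q.1) && (p.2 == q.2).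
    by case: p q => [? ?] [? ?].
  by rewrite pair_eq -iE -jE -kE -lE !(inj_eq lab_inj).
rewrite -iE -jE -kE -lE in ltx lty *.
case: (boolP ((i == k) && (j == l))) => [/andP[/eqP ik /eqP jl] /eqP->|neq].
  by rewrite xE yE ik jl (eqP (_ : rel_index S _ _ == ord0)) // rel_index_eq0.
case: (boolP [|| i == k, i == l, j == k | j == l]) => [share /eqP->|].
  have -> // : rel_index S x y = 2%R; rewrite xE yE.
  case/or4P: share => /eqP E; subst.
  - rewrite eqxx /= in neq; apply: adj; rewrite /= !inE negb_or ij kl neq //.
  - rewrite [pt k l]sym; apply: adj; rewrite /= !inE negb_or ij eq_sym kl /= andbT.
    by apply: contraTneq ltx => ->; rewrite -leqNgt ltnW.
  - rewrite [pt i k]sym; apply: adj; rewrite /= !inE negb_or eq_sym ij kl /= andbT.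
    by apply: contraTneq ltx => ->; rewrite -leqNgt ltnW.
  - rewrite [pt i l]sym [pt k l]sym; apply: adj.
    by rewrite /= !inE negb_or eq_sym ij eq_sym kl /= andbT; move: neq; rewrite eqxx andbT.
rewrite !negb_or => /and4P[ik il jk jl].
have un : uniq [:: i; j; k; l] by rewrite /= !inE !negb_or ij ik il jk jl kl.
have := sigE _ _ _ _ un; rewrite /sig /split_rel /model_rel -xE -yE.
have := nadj _ _ _ _ un; rewrite -xE -yE => -[] -> /= sE /orP[] /eqP nE.
- by rewrite nE in sE.
- by rewrite nE.
- by rewrite nE.
- by rewrite nE in sE.
Qed.

Theorem theorem1 (P : finType) (W : {set {set P}})
    (hW : is_design 4 11 5 1 W)
    (X : finType) (S : symmetric_scheme 3 X)
    (hS : forall i j k : 'I_4, inter_num S i j k = witt_inter_num i j k) :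
  exists phi : X -> block W,
    bijective phi /\
    forall (i : 'I_4) (x y : X),
      ((x, y) \in S i) = block_rel i (phi x) (phi y).
Proof.
have [f [f_model f_overlap]] := scheme_blocks hS.
have cardP : #|P| = 11 by case: hW.
have /card_gt0P[x0 _] : 0 < #|P| by rewrite cardP.
have [pos [pos_inj pos11 WE]] := witt_unique hW x0.
pose g b : {set P} := [set p | nth false b (pos p)].
have gW x : g (f x) \in W by rewrite WE; apply: (map_f g).
pose phi x : block W := exist _ (g (f x)) (gW x).
have cap x y : #|val (phi x) :&: val (phi y)| = overlap_value (rel_index S x y).
  by rewrite -f_overlap -(card_overlap cardP pos_inj pos11) ?size_model_blocks.
have val_lt (i : 'I_4) : overlap_value i <= 5 by case: i => [[|[|[|[|]]]]].
have phi_eq x y : (phi x == phi y) = (rel_index S x y == ord0).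
  apply/eqP/eqP => [E|/eqP]; last by rewrite rel_index_eq0 => /eqP->.
  have := cap x y; rewrite E setIid.
  rewrite (witt_block_card hW (gW y)); case: (rel_index S x y) => [[|[|[|[|]]]]] //= lt_k _.
  exact: val_inj.
have phi_inj : injective phi by move=> x y /eqP; rewrite phi_eq rel_index_eq0 => /eqP.
exists phi; split.
  (* W has at most 66 blocks, because each comes from one of the 66 entries of [model_blocks]. *)
  apply: inj_card_bij phi_inj _; rewrite (card_scheme hS) card_sig.
  have sub : {subset W <= map g model_blocks} by move=> B; rewrite WE.
  have -> : 66 = size (map g model_blocks) by rewrite size_map; vm_compute.
  apply: leq_trans (card_size _); exact/subset_leq_card/subsetP.
move=> i x y; rewrite rel_indexE /block_rel phi_eq cap [in RHS]eq_sym.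
by case: (rel_index S x y) i => [[|[|[|[|k]]]] //= lt_k] [[|[|[|[|i]]]] //= lt_i].
Qed.
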